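(* Let $1\le q\le 2$. There exists a constant $C$ depending only on $q$ such that the following holds. Let $(\Omega,\mathcal A,\mu)$ be a probability space, let $X$ be distributed as $\mu$, let $\mathcal F\subset L^q(\mu)$ be a class of real-valued functions on $\Omega$ containing the zero function, and suppose that $\mathcal F$ has sub-Gaussian increments with respect to a distance $d_{\psi_2}$ on $\mathcal F$. Let $N\ge1$ be an integer and let $X_1,\dots,X_N$ be independent copies of $X$. Put $$Z=\sup_{f\in\mathcal F}\left|\frac1N\sum_{i=1}^N|f(X_i)|^q-\mathbb E|f(X)|^q\right|.$$ Then for every $x\ge 1$, with probability at least $1-\exp(-x)$, $$Z\le C\left(\frac{\gamma_2(\mathcal F,d_{\psi_2})^q}{N^{q/2}}+\operatorname{diam}(\mathcal F,d_{\psi_2})^{q-1}\frac{\gamma_2(\mathcal F,d_{\psi_2})}{\sqrt N}+\operatorname{diam}(\mathcal F,d_{\psi_2})^q\left(\sqrt{\frac xN}+\left(\frac xN\right)^{q/2}\right)\right).$$ Moreover, for every $1\le p<\infty$, $$\left(\mathbb E\, Z^p\right)^{1/p}\le C\left(\frac{\gamma_2(\mathcal F,d_{\psi_2})^q}{N^{q/2}}+\operatorname{diam}(\mathcal F,d_{\psi_2})^{q-1}\frac{\gamma_2(\mathcal F,d_{\psi_2})}{\sqrt N}+\operatorname{diam}(\mathcal F,d_{\psi_2})^q\left(\sqrt{\frac pN}+\left(\frac pN\right)^{q/2}\right)\right).$$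
   Context: Sub-Gaussian increments: $\mathcal F$ has sub-Gaussian increments with respect to the distance $d_{\psi_2}$ if, for some absolute constant $C_1>1$ (fixed once and for all), for all $f,g\in\mathcal F$ and all $u>0$, $\mathbb P(|f(X)-g(X)|\ge u)\le C_1\exp\left(-u^2/d_{\psi_2}(f,g)^2\right)$. Talagrand's functional: for a metric space $(T,d)$, a sequence $(T_n)_{n\ge 0}$ of finite subsets of $T$ is admissible if $|T_0|=1$, $|T_n|\le 2^{2^n}$, $T_n\subset T_{n+1}$, and $\bigcup_{n\ge0}T_n$ is dense in $T$. Then $\gamma_2(T,d)=\inf\sup_{v\in T}\sum_{n=0}^\infty 2^{n/2}d(v,T_n)$, where the infimum is over all admissible sequences. $\operatorname{diam}(\mathcal F,d_{\psi_2})$ is the diameter of $\mathcal F$ with respect to $d_{\psi_2}$.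
   Formalization: The supremum Z is taken as the least almost-sure upper bound (essential supremum) of the family over the class, which equals the pointwise supremum for countable or separable classes; with the pointwise supremum over an arbitrary uncountable class the claim is false. *)

(* Defs.v *)
From HB Require Import structures.
From mathcomp Require Import all_boot all_order all_algebra.
From mathcomp Require Import all_classical all_reals all_analysis.
From mathcomp Require Import measurable_realfun.

Set Implicit Arguments.
Unset Strict Implicit.
Unset Printing Implicit Defensive.

Import Order.TTheory GRing.Theory Num.Theory.
Import numFieldNormedType.Exports.

Local Open Scope classical_set_scope.
Local Open Scope ring_scope.
Local Open Scope ereal_scope.

(* Only the values of [rho] on [F] matter. *)
Definition is_distance (R : realType) (U : Type) (F : set U)
    (rho : U -> U -> R) : Prop :=
  [/\ forall f g, F f -> F g -> (0 <= rho f g)%R,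
      forall f g, F f -> F g -> (rho f g = 0%R <-> f = g),
      forall f g, F f -> F g -> rho f g = rho g f &
      forall f g h, F f -> F g -> F h -> (rho f h <= rho f g + rho g h)%R].

Definition diam (R : realType) (U : Type) (F : set U) (rho : U -> U -> R)
    : \bar R :=
  ereal_sup [set e | exists f g, [/\ F f, F g & e = (rho f g)%:E]].

Definition dist_to (R : realType) (U : Type) (rho : U -> U -> R) (v : U)
    (A : set U) : \bar R :=
  ereal_inf [set (rho v a)%:E | a in A].

(* [A #<= `I_m] says that [A] is finite with at most [m] elements. *)
Definition admissible (R : realType) (U : Type) (F : set U)
    (rho : U -> U -> R) (A : nat -> set U) : Prop :=
  [/\ forall n, A n `<=` F,
      (A 0%N #= `I_1)%card,
      forall n, (A n #<= `I_(2 ^ (2 ^ n))%N)%card,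
      forall n, A n `<=` A n.+1 &
      forall v, F v -> forall e : R, (0 < e)%R ->
        exists n a, A n a /\ (rho v a < e)%R].

(* The value is [+oo] when there is no admissible sequence, i.e. when [F] is
   not separable. *)
Definition gamma2 (R : realType) (U : Type) (F : set U) (rho : U -> U -> R)
    : \bar R :=
  ereal_inf [set ereal_sup
      [set \sum_(0 <= n <oo) ((2 `^ (n%:R / 2))%R)%:E * dist_to rho v (A n)
         | v in F]
    | A in admissible F rho].

Definition subgaussian_increments d d' (T : measurableType d)
    (S : measurableType d') (R : realType) (P : probability S R)
    (X : {RV P >-> T}) (F : set (T -> R)) (C1 : R)
    (rho : (T -> R) -> (T -> R) -> R) : Prop :=
  forall f g, F f -> F g -> forall u : R, (0 < u)%R ->
    P [set w | (u <= `|f (X w) - g (X w)|)%R] <=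
      (C1 * expR (- (u ^+ 2 / rho f g ^+ 2)))%:E.

(* For a finite family, the product rule over subfamilies is the case where
   some of the [B i] are the whole space. *)
Definition mutually_independent d d' (T : measurableType d)
    (S : measurableType d') (R : realType) (P : probability S R) (N : nat)
    (X : 'I_N -> {RV P >-> T}) : Prop :=
  forall B : 'I_N -> set T, (forall i, measurable (B i)) ->
    P [set w | forall i, B i (X i w)] = \prod_(i < N) P (X i @^-1` B i).

(* The supremum in the ordered space of extended real-valued random variables
   modulo almost sure equality.  It exists for every family of measurable
   functions ([exists_rv_sup]), it is almost surely unique ([rv_sup_unique]),
   and it is the pointwise supremum when the family is countable
   ([rv_sup_countable]) or, more generally, separable ([rv_sup_separable]).  The
   pointwise supremum of an uncountable family need not be measurable, and it
   changes when each member is modified on a null set. *)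
Definition is_rv_sup d' (S : measurableType d') (R : realType)
    (P : probability S R) (I : Type) (D : set I) (Y : I -> S -> \bar R)
    (Z : S -> \bar R) : Prop :=
  [/\ measurable_fun setT Z,
      forall i, D i -> {ae P, forall w, Y i w <= Z w} &
      forall W : S -> \bar R, measurable_fun setT W ->
        (forall i, D i -> {ae P, forall w, Y i w <= W w}) ->
        {ae P, forall w, Z w <= W w}].

Section rv_sup.
Context d' (S : measurableType d') (R : realType) (P : probability S R).
Context (I : Type) (D : set I) (Y : I -> S -> \bar R).

Lemma rv_sup_unique (Z Z' : S -> \bar R) :
  is_rv_sup P D Y Z -> is_rv_sup P D Y Z' -> {ae P, forall w, Z w = Z' w}.
Proof.
move=> [mZ uZ lZ] [mZ' uZ' lZ'].
have h1 := lZ _ mZ' uZ'; have h2 := lZ' _ mZ uZ.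
by apply: filterS2 h1 h2 => w a b; apply/eqP; rewrite eq_le a b.
Qed.

Let countable_enum (G : set I) : countable G ->
  exists s : nat -> option I, (forall n i, s n = Some i -> G i) /\
    (forall i, G i -> exists n, s n = Some i).
Proof.
move=> /countable_injP[f injf].
have h n : exists o : option I, (forall i, o = Some i -> G i) /\
    (forall i, G i -> f i = n -> o = Some i).
  have [[i [Gi fi]]|no] := pselect (exists i, G i /\ f i = n); last first.
    by exists None; split=> // i Gi fi; case: no; exists i.
  exists (Some i); split=> [_ [<-]//|j Gj fj]; congr Some.
  by apply: injf; rewrite ?inE// fi fj.
have [s hs] := choice h.
exists s; split=> [n i|i Gi]; first by case: (hs n) => + _; exact.
by exists (f i); case: (hs (f i)) => _; exact.
Qed.

Let countable_bigcup_measurable (G : set I) (A : I -> set S) :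
  countable G -> (forall i, G i -> measurable (A i)) ->
  measurable (\bigcup_(i in G) A i).
Proof.
move=> /countable_enum[s [sG Gs]] mA.
rewrite (_ : bigcup _ _ = \bigcup_n (oapp A set0 (s n))).
  apply: bigcupT_measurable => n; case E : (s n) => [i|] //=.
  exact/mA/(sG n).
apply/seteqP; split=> w [].
  by move=> i /Gs[n sn] Aw; exists n; rewrite ?sn.
move=> n _; case E : (s n) => [i|] //= Aw; exists i => //; exact: sG E.
Qed.

Let countable_ae (G : set I) (Q : I -> S -> Prop) : countable G ->
  (forall i, G i -> {ae P, forall w, Q i w}) ->
  {ae P, forall w, forall i, G i -> Q i w}.
Proof.
move=> /countable_enum[s [sG Gs]] hQ.
have : {ae P, forall w, forall n, oapp (fun i => Q i w) True (s n)}.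
  apply: ae_foralln => n; case E : (s n) => [i|] /=; last exact: aeW.
  exact/hQ/(sG n).
by apply: filterS => w h i /Gs[n sn]; have := h n; rewrite sn.
Qed.

Let psup (G : set I) (w : S) : \bar R := ereal_sup [set Y i w | i in G].

Context (mY : forall i, D i -> measurable_fun setT (Y i)).

Let psup_gtE (G : set I) (r : R) :
  [set w | r%:E < psup G w] = \bigcup_(i in G) [set w | r%:E < Y i w].
Proof.
apply/seteqP; split=> w /=.
  by move=> /ereal_sup_gt[_ [i Gi <-] ?]; exists i.
move=> [i Gi /= h]; apply: lt_le_trans h _; apply: ereal_sup_ubound.
by exists i.
Qed.

Let measurable_gt (G : set I) (r : R) : countable G -> G `<=` D ->
  measurable [set w | r%:E < psup G w].
Proof.
move=> cG GD; rewrite psup_gtE; apply: countable_bigcup_measurable => // i Gi.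
by rewrite -[X in measurable X]setTI; apply: emeasurable_fun_o_infty => //;
  exact/mY/GD.
Qed.

Let measurable_psup (G : set I) : countable G -> G `<=` D ->
  measurable_fun setT (psup G).
Proof.
move=> cG GD mT; apply: (measurability _ (ErealGenOInfty.measurableE R)) => //.
move=> _ [_ [r ->] <-]; rewrite setTI.
rewrite (_ : _ @^-1` _ = [set w | r%:E < psup G w]); first exact: measurable_gt.
by apply/seteqP; split=> w /=; rewrite in_itv/= andbT.
Qed.

Lemma rv_sup_separable (G : set I) : countable G -> G `<=` D ->
  (forall i, D i -> {ae P, forall w, Y i w <= ereal_sup [set Y j w | j in G]}) ->
  is_rv_sup P D Y (fun w => ereal_sup [set Y i w | i in G]).
Proof.
move=> cG GD h; split; [exact: measurable_psup| exact: h|].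
move=> W mW hW.
have := countable_ae cG (fun i Gi => hW i (GD _ Gi)).
apply: filterS => w hw; apply: ge_ereal_sup => _ [i Gi <-]; exact: hw.
Qed.

Lemma rv_sup_countable : countable D ->
  is_rv_sup P D Y (fun w => ereal_sup [set Y i w | i in D]).
Proof.
move=> cD; apply: rv_sup_separable => // i Di; apply: aeW => w.
by apply: ereal_sup_ubound; exists i.
Qed.

Let psup_le (G G' : set I) w : G `<=` G' -> psup G w <= psup G' w.
Proof.
move=> GG'; apply: ge_ereal_sup => _ [i Gi <-]; apply: ereal_sup_ubound.
by exists i => //; exact: GG'.
Qed.

Let exists_max_level (r : R) : exists G, [/\ countable G, G `<=` D &
  forall G', countable G' -> G' `<=` D ->
    P [set w | r%:E < psup G' w] <= P [set w | r%:E < psup G w]].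
Proof.
pose V := [set P [set w | r%:E < psup G w]
  | G in [set G | countable G /\ G `<=` D]].
pose M := ereal_sup V.
have Mfin : M \is a fin_num.
  rewrite ge0_fin_numE; last first.
    apply: (@le_trans _ _ (P [set w | r%:E < psup set0 w])) => //.
    by apply: ereal_sup_ubound; exists set0 => //; split; [exact: countable0|].
  apply: (@le_lt_trans _ _ 1); last exact: ltry.
  apply: ge_ereal_sup => _ [G [cG GD] <-].
  by apply: probability_le1; exact: measurable_gt.
have {}/choice[H HP] : forall k : nat, exists G, (countable G /\ G `<=` D) /\
    M - (k.+1%:R^-1)%:E < P [set w | r%:E < psup G w].
  move=> k; have [||_ [G [cG GD] <-] h] := @ub_ereal_sup_adherent R V k.+1%:R^-1.
  - by rewrite invr_gt0.
  - exact: Mfin.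
  - by exists G.
have cU : countable (\bigcup_k H k).
  by apply: bigcup_countable => // k _; case: (HP k) => -[].
have UD : \bigcup_k H k `<=` D by move=> i [k _];
  case: (HP k) => -[_ +] _; exact.
exists (\bigcup_k H k); split => // G' cG' G'D.
apply: (@le_trans _ _ M); first by apply: ereal_sup_ubound; exists G'.
apply/lee_addgt0Pr => e e0.
have [k ke] : exists k : nat, (k.+1%:R^-1 < e)%R.
  have [k _ /(_ k (leqnn _)) ke] := near_infty_natSinv_lt (PosNum e0).
  by exists k.
have [[cH HD] hk] := HP k.
rewrite -leeBlDr//; apply: le_trans (_ : M - (k.+1%:R^-1)%:E <= _).
  by rewrite leeB// lee_fin ltW.
apply: (le_trans (ltW hk)); apply: le_measure; rewrite ?inE.
- exact: measurable_gt.
- exact: measurable_gt.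
- move=> w /= /lt_le_trans; apply; apply: psup_le => i Hi.
  by exists k.
Qed.

Let rat_between (x y : \bar R) : x < y ->
  exists t : rat, x <= (ratr t)%:E /\ (ratr t)%:E < y.
Proof.
case: x y => [x| |] [y| |]//= xy.
- have /rat_in_itvoo[t] : (x < y)%R by rewrite -lte_fin.
  rewrite in_itv/= => /andP[a b]; exists t; rewrite lee_fin lte_fin; split=> //.
  exact: ltW.
- have /rat_in_itvoo[t] : (x < x + 1)%R by rewrite ltrDl.
  rewrite in_itv/= => /andP[a b]; exists t; rewrite lee_fin ltry; split=> //.
  exact: ltW.
- have /rat_in_itvoo[t] : (y - 1 < y)%R by rewrite ltrBlDr ltrDl.
  rewrite in_itv/= => /andP[a b]; exists t; rewrite leNye lte_fin; split=> //.
- by exists 0%R; rewrite leNye ltry.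
Qed.

Lemma exists_rv_sup : exists Z, is_rv_sup P D Y Z.
Proof.
have /choice[H HP] : forall t : rat, _ := fun t => exists_max_level (ratr t).
pose G := \bigcup_t H t.
have cG : countable G.
  apply: bigcup_countable; first exact: countableP.
  by move=> t _; case: (HP t).
have GD : G `<=` D by move=> i [t _]; case: (HP t) => _ + _; exact.
exists (psup G); apply: rv_sup_separable => // i Di.
rewrite -/(psup G).
pose B (t : rat) :=
  [set w | (ratr t)%:E < Y i w] `\` [set w | (ratr t)%:E < psup G w].
have mB t : measurable (B t).
  apply: measurableD; last exact: measurable_gt.
  by rewrite -[X in measurable X]setTI; apply: emeasurable_fun_o_infty => //;
    exact/mY.
have PB t : P (B t) = 0.
  have [_ _ mx] := HP t.
  have cGi : countable (G `|` [set i]).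
    rewrite -bigcup2E; apply: bigcup_countable => // -[|[|n]] _ /=;
      [exact: cG| |exact: countable0].
    exact: countable1.
  have GiD : G `|` [set i] `<=` D by move=> j [/GD//|->].
  have HG : P [set w | (ratr t)%:E < psup (H t) w] <=
      P [set w | (ratr t)%:E < psup G w].
    have [cH HD _] := HP t.
    apply: le_measure; rewrite ?inE; [exact: measurable_gt|exact: measurable_gt|].
    move=> w /= /lt_le_trans; apply; apply: psup_le => j Hj.
    by exists t.
  have := le_trans (mx _ cGi GiD) HG.
  have -> : [set w | (ratr t)%:E < psup (G `|` [set i]) w] =
      [set w | (ratr t)%:E < psup G w] `|` B t.
    rewrite !psup_gtE bigcup_setU bigcup_set1 /B psup_gtE.
    by rewrite setDE setUIr setUCr setIT.
  rewrite measureU//; [|exact: measurable_gt|by rewrite /B setDIK].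
  move=> h; apply/eqP; rewrite eq_le measure_ge0 andbT.
  move: h; rewrite -[leRHS]adde0 leeD2lE// ge0_fin_numE//.
  apply: le_lt_trans (probability_le1 _ _) _; [exact: measurable_gt|exact: ltry].
have : {ae P, forall w, forall t : rat, ~ B t w}.
  have hae : forall n : nat,
      {ae P, forall w, oapp (fun t : rat => ~ B t w) True (unpickle n)}.
    move=> n; case: (unpickle n) => [t|] /=; last exact: aeW.
    by exists (B t); split => // w /=; apply: contrapT.
  have := ae_foralln hae; apply: filterS => w h t.
  by have := h (pickle t); rewrite pickleK.
apply: filterS => w h; rewrite leNgt; apply/negP => /rat_between[t [a b]].
by apply: (h t); split=> //=; apply/negP; rewrite -leNgt.
Qed.

End rv_sup.

(* The deviation of the empirical [q]-th absolute moment of [f] over the sample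
   [Xs] from the true one. *)
Definition moment_dev d d' (T : measurableType d) (S : measurableType d')
    (R : realType) (P : probability S R) (q : R) (N : nat) (X : {RV P >-> T})
    (Xs : 'I_N -> {RV P >-> T}) (f : T -> R) (w : S) : \bar R :=
  `| (N%:R^-1 * \sum_(i < N) `|f (Xs i w)| `^ q)%R%:E
     - 'E_P[fun v => (`|f (X v)| `^ q)%R] |.

(* [t] is the confidence level [x] in the tail bound and the exponent [p] in the
   moment bound. *)
Definition moment_dev_bound (R : realType) (q : R) (gam Del : \bar R) (N : nat)
    (t : R) : \bar R :=
  gam `^ q * ((N%:R `^ (q / 2))^-1)%R%:E
  + Del `^ (q - 1) * (gam * ((Num.sqrt N%:R)^-1)%R%:E)
  + Del `^ q * (Num.sqrt (t / N%:R) + (t / N%:R) `^ (q / 2))%R%:E.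

(* Main.v *)
Require Import Defs.
From HB Require Import structures.
From mathcomp Require Import all_boot all_order all_algebra.
From mathcomp Require Import all_classical all_reals all_analysis.
From mathcomp Require Import measurable_realfun zify ring lra.

(** The proof is generic chaining, with three regimes along the chain.

    Fix a confidence level [x], a nearly optimal admissible sequence and, for
    each [f] in the class, the nearest points [p k] of [f] at the levels [k].
    Let [2 ^ r] be about [x] and [2 ^ s] about [N].

    - At the level [r] the class is replaced by [2 ^ 2 ^ r] functions, a number
      exponential in [x], and a union bound over the deviations of the
      [|p r| ^ q] costs only the terms in [x].
    - Between the levels [r] and [s] the increments [|p k.+1| ^ q - |p k| ^ q]
      have exponential moments at the scale [Delta ^ (q - 1) * rho (p k.+1) (p k)]
      ([power_increment_exp_moment]).  As long as [2 ^ k] is at most of order [N]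
      this gives sub-Gaussian deviations of order [sqrt (2 ^ k / N)]
      ([bernstein]), whose sum is the term in [gamma / sqrt N].
    - Beyond the level [s] cancellations are given up.  The empirical [L^2] norm
      of an increment is at most of order [rho * sqrt (2 ^ k / N)]
      ([sum_sqr_tail]), so [f] differs from [p s] by at most
      [gamma / sqrt N] in that norm; the inequality
      [| |a| ^ q - |b| ^ q | <= 2 * |a - b| * (|a| ^ (q - 1) + |b| ^ (q - 1))] and
      Jensen's inequality, which need [q <= 2], turn this into a bound for the
      [q]-th powers.

    When [x] exceeds [N] the middle regime is empty and the [L^2] bound alone
    suffices.  All events are unions over pairs of points of one level;
    [levels_good_event] sums their masses, and [chaining_bound] is the
    deterministic part, carried out outcome by outcome.  A fixed [f] needs only
    finitely many levels, up to an event of arbitrarily small mass, so the bound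
    holds almost surely on the good event for each [f], which is what the
    supremum modulo null sets requires ([rv_sup_le_on]).

    The bound at level [y * p] is at most [y] times the bound at [p], so the tails
    decay exponentially at the scale given by [p], and summing them over
    layers yields the moment of order [p] ([moment_of_tail]).

    The factorization of exponential moments over independent samples is derived
    from the product rule for events ([integral_prod_independent]). *)

Set Implicit Arguments.
Unset Strict Implicit.
Unset Printing Implicit Defensive.

Import Order.TTheory GRing.Theory Num.Theory.
Import numFieldNormedType.Exports.

Local Open Scope classical_set_scope.
Local Open Scope ring_scope.
(** * Real inequalities *)

Section real_inequalities.
Context {R : realType}.
Implicit Types (a b x y q : R).

(** Both signs of [y] follow from [expR z >= 1 + z]: it gives
    [expR y - 1 <= y * expR y], hence the left side is at most
    [1 + y + y * (expR y - 1)]. *)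
Lemma expR_le_quadratic y : expR y <= 1 + y + y ^+ 2 * expR `|y|.
Proof.
have e1 : expR y - 1 <= y * expR y.
  have := expR_ge1Dx (- y); rewrite expRN => h.
  have := expR_gt0 y => e0.
  have : (1 - y) * expR y <= 1.
    by have := ler_wpM2r (ltW e0) h; rewrite mulVf ?gt_eqF.
  by lra.
have e2 := expR_ge1Dx y.
have [y0|y0] := leP 0 y.
  rewrite (ger0_norm y0); have : y * (expR y - 1) <= y * (y * expR y).
    by rewrite ler_wpM2l.
  rewrite expr2; lra.
rewrite (ltr0_norm y0).
have : y * (expR y - 1) <= y * y by rewrite ler_wnM2l; lra.
have : y ^+ 2 * 1 <= y ^+ 2 * expR (- y).
  by rewrite ler_wpM2l ?sqr_ge0// ltW// expR_gt1; lra.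
rewrite expr2; lra.
Qed.

Lemma pow2_le_expR n : (2 ^ n)%:R <= expR n%:R :> R.
Proof.
rewrite -[n%:R]mulr1 expRM_natl natrX lerXn2r ?nnegrE ?expR_ge0//.
by have := @expR_ge1Dx R 1; lra.
Qed.

Lemma sqr_le_expR y : 0 <= y -> y ^+ 2 <= 4 * expR y.
Proof.
move=> y0; have h := expR_ge1Dx (y / 2).
have -> : expR y = expR (y / 2) ^+ 2 by rewrite -expRM_natr; congr expR; lra.
have : (y / 2) ^+ 2 <= expR (y / 2) ^+ 2 by rewrite ler_pXn2r ?nnegrE ?expR_ge0//; lra.
rewrite exprMn; lra.
Qed.

(** Against [sqr_le_expR], half of the exponent pays for the square. *)
Lemma sqr_expR_le y : 0 <= y -> y ^+ 2 * expR (y / 2) <= 16 * expR y.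
Proof.
move=> y0; have h : (y / 2) ^+ 2 <= 4 * expR (y / 2).
  by apply: sqr_le_expR; lra.
have -> : expR y = expR (y / 2) * expR (y / 2).
  by rewrite -expRD; congr expR; lra.
rewrite mulrA ler_wpM2r ?expR_ge0//.
by move: h; rewrite exprMn; lra.
Qed.

Lemma sqrtr_le_of_sqr x y : 0 <= y -> x <= y ^+ 2 -> Num.sqrt x <= y.
Proof. by move=> y0 h; rewrite -[leRHS](ger0_norm y0) -sqrtr_sqr ler_wsqrtr. Qed.

Lemma powR_le_affine x t : 0 <= t <= 1 -> 0 <= x -> x `^ t <= t * x + (1 - t).
Proof.
move=> /andP[t0 t1]; rewrite le_eqVlt => /predU1P[<-|x0].
  by rewrite mulr0 add0r; have [->|tn] := eqVneq t 0;
    rewrite ?powRr0 ?subr0// powR0// subr_ge0.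
have := @convex_expR R (Itv01 t0 t1) (ln x) 0.
rewrite !convRE/= mulr0 addr0 lnK ?posrE// expR0 mulr1.
by rewrite /powR gt_eqF// onem_ge0.
Qed.

(** On [[0, 1]] the graph of [z |-> z ^ q] lies above that of [z ^ 2], and
    [1 - z ^ 2 <= 2 * (1 - z)]. *)
Lemma powR_sub_le q a b : 1 <= q <= 2 -> 0 <= b <= a ->
  a `^ q - b `^ q <= 2 * (a - b) * a `^ (q - 1).
Proof.
move=> /andP[q1 q2] /andP[b0 ba].
have [a0|a0] := eqVneq a 0.
  have b00 : b = 0 by apply/eqP; rewrite eq_le b0 -a0 ba.
  by rewrite a0 b00 !subrr mulr0 mul0r.
have {a0} a0 : 0 < a by rewrite lt_neqAle eq_sym a0 (le_trans b0).
pose z := b / a.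
have z0 : 0 <= z by rewrite divr_ge0// ltW.
have z1 : z <= 1 by rewrite ler_pdivrMr// mul1r.
have bE : b = a * z by rewrite /z mulrC divfK// gt_eqF.
clearbody z.
rewrite bE powRM// ?(ltW a0)//.
rewrite -(mulr_powRB1 (ltW a0)) ?(lt_le_trans _ q1)//.
have hz : z ^+ 2 <= z `^ q.
  have [->|zn] := eqVneq z 0; first by rewrite expr0n/= powR_ge0.
  have zp : 0 < z by rewrite lt_neqAle eq_sym zn.
  by rewrite -powR_mulrn// ger_powR// zp.
have P := powR_ge0 a (q - 1).
have : 1 - z `^ q <= 2 * (1 - z) by rewrite expr2 in hz; nra.
move=> /(ler_wpM2l (mulr_ge0 (ltW a0) P)); lra.
Qed.

Lemma powR_norm_sub_le q a b : 1 <= q <= 2 ->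
  `| `|a| `^ q - `|b| `^ q | <=
    2 * `|a - b| * (`|a| `^ (q - 1) + `|b| `^ (q - 1)).
Proof.
move=> q12; wlog ba : a b / `|b| <= `|a|.
  move=> h; have [/h//|/ltW/h] := leP `|b| `|a|.
  by rewrite distrC (distrC b) (addrC (_ `^ (q - 1))).
have q0 : 0 <= q by case/andP: q12; lra.
rewrite ger0_norm; last first.
  by rewrite subr_ge0 ge0_ler_powR ?nnegrE.
apply: (le_trans (powR_sub_le q12 _)); first by rewrite normr_ge0.
have h : `|a| - `|b| <= `|a - b| by exact: lerB_dist.
have P := powR_ge0 `|a| (q - 1); have P' := powR_ge0 `|b| (q - 1).
rewrite -!mulrA ler_pM2l// mulrDr.
rewrite -[leLHS]addr0 lerD// ?mulr_ge0// ler_wpM2r//.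
Qed.

(** With [z = b / a <= 1] this is [(1 + z) ^ t <= 1 + t * z <= 1 + z ^ t]. *)
Lemma powRD_le t a b : 0 <= t <= 1 -> 0 <= a -> 0 <= b ->
  (a + b) `^ t <= a `^ t + b `^ t.
Proof.
move=> /andP[t0 t1]; wlog ba : a b / b <= a.
  move=> h a0 b0; have [/h|/ltW/h] := leP b a; first exact.
  by rewrite addrC (addrC (a `^ t)); apply.
move=> a0 b0.
have [a00|a00] := eqVneq a 0.
  have -> : b = 0 by apply/eqP; rewrite eq_le b0 -a00 ba.
  by rewrite addr0 lerDl powR_ge0.
have {a00} a00 : 0 < a by rewrite lt_neqAle eq_sym a00.
pose z := b / a.
have z0 : 0 <= z by rewrite divr_ge0// ltW.
have z1 : z <= 1 by rewrite ler_pdivrMr// mul1r.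
have bE : b = a * z by rewrite /z mulrC divfK// gt_eqF.
clearbody z.
have -> : a + b = a * (1 + z) by rewrite mulrDr mulr1 -bE.
rewrite bE !powRM//; last by rewrite addr_ge0.
rewrite -[X in _ <= X + _]mulr1 -mulrDr ler_wpM2l ?powR_ge0//.
have h : (1 + z) `^ t <= 1 + t * z.
  have := @powR_le_affine (1 + z) t; rewrite t0 t1 addr_ge0// => /(_ isT isT).
  lra.
apply: (le_trans h); rewrite lerD2l.
have [->|zn] := eqVneq z 0; first by rewrite mulr0 powR_ge0.
have zp : 0 < z by rewrite lt_neqAle eq_sym zn.
apply: (@le_trans _ _ (z `^ 1)); last by rewrite ger_powR// zp.
by rewrite powRr1// ler_piMl.
Qed.

Lemma powR2_le4 q : q <= 2 -> 2 `^ q <= 4 :> R.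
Proof.
move=> q2; apply: (@le_trans _ _ (2 `^ 2%:R)); first by rewrite ler_powR// ler1n.
by rewrite powR_mulrn// -natrX.
Qed.

Lemma powRD_le4 q a b : 1 <= q <= 2 -> 0 <= a -> 0 <= b ->
  (a + b) `^ q <= 4 * (a `^ q + b `^ q).
Proof.
move=> /andP[q1 q2]; wlog ba : a b / b <= a.
  move=> h a0 b0; have [/h|/ltW/h] := leP b a; first exact.
  by rewrite addrC (addrC (a `^ q)); apply.
move=> a0 b0; have P := powR_ge0 a q; have P' := powR_ge0 b q.
apply: (@le_trans _ _ ((2 * a) `^ q)).
  by rewrite ge0_ler_powR ?nnegrE ?addr_ge0 ?mulr_ge0//; lra.
by rewrite powRM//; have := ler_wpM2r P (powR2_le4 q2); lra.
Qed.

End real_inequalities.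

(** * The Euclidean norm on finite families *)

Section euclidean_norm.
Context {R : realType} {N : nat}.
Implicit Types (u v h g : 'I_N -> R).

Definition l2norm u : R := Num.sqrt (\sum_i u i ^+ 2).

Lemma l2norm_ge0 u : 0 <= l2norm u.
Proof. exact: sqrtr_ge0. Qed.

Lemma sqr_l2norm u : l2norm u ^+ 2 = \sum_i u i ^+ 2.
Proof. by rewrite sqr_sqrtr// sumr_ge0// => i _; rewrite sqr_ge0. Qed.

Lemma l2norm_normr u : l2norm (fun i => `|u i|) = l2norm u.
Proof. by congr Num.sqrt; apply: eq_bigr => i _; rewrite real_normK ?num_real. Qed.

(** Lagrange's identity: the two sides, squared, differ by half the sum of the
    squares [(u i * v j - u j * v i) ^+ 2]. *)
Lemma sum_mul_le_l2norm u v : \sum_i u i * v i <= l2norm u * l2norm v.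
Proof.
suff h : (\sum_i u i * v i) ^+ 2 <= (l2norm u * l2norm v) ^+ 2.
  have [s0|/ltW s0] := leP 0 (\sum_i u i * v i).
    by rewrite -ler_sqr// nnegrE mulr_ge0// l2norm_ge0.
  by apply: (le_trans s0); rewrite mulr_ge0// l2norm_ge0.
rewrite exprMn !sqr_l2norm.
have : 0 <= \sum_i \sum_j (u i * v j - u j * v i) ^+ 2.
  by apply: sumr_ge0 => i _; apply: sumr_ge0 => j _; rewrite sqr_ge0.
have -> : \sum_i \sum_j (u i * v j - u j * v i) ^+ 2 =
    (\sum_i u i ^+ 2) * (\sum_i v i ^+ 2) + (\sum_i v i ^+ 2) * (\sum_i u i ^+ 2)
    - 2 * ((\sum_i u i * v i) * (\sum_i u i * v i)).
  rewrite !big_distrlr/= mulr_sumr -big_split -sumrB/=; apply: eq_bigr => i _.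
  rewrite mulr_sumr -big_split -sumrB/=; apply: eq_bigr => j _.
  by ring.
rewrite expr2; lra.
Qed.

Lemma l2normD u v : l2norm (fun i => u i + v i) <= l2norm u + l2norm v.
Proof.
rewrite -ler_sqr ?nnegrE ?addr_ge0 ?l2norm_ge0//.
rewrite sqr_l2norm sqrrD !sqr_l2norm.
under eq_bigr do rewrite sqrrD -mulr_natl.
rewrite !big_split/= lerD2r lerD2l -mulr_sumr.
have := sum_mul_le_l2norm u v; lra.
Qed.

(** Jensen: after scaling the [v i] to have mean [1], each [v i `^ t] is below
    its tangent line at [1]. *)
Lemma sum_powR_le t v : 0 <= t <= 1 -> (0 < N)%N -> (forall i, 0 <= v i) ->
  \sum_i v i `^ t <= N%:R `^ (1 - t) * (\sum_i v i) `^ t.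
Proof.
move=> /andP[t0 t1] N0 v0; set s := \sum_i v i.
have NR : 0 < N%:R :> R by rewrite ltr0n.
have s0 : 0 <= s by exact: sumr_ge0.
have [s00|sn] := eqVneq s 0.
  have vz i : v i = 0.
    by apply: (psumr_eq0P (fun i _ => v0 i) s00).
  under eq_bigr do rewrite vz.
  rewrite s00 sumr_const card_ord -[_ `^ t *+ N]mulr_natr.
  have [->|tn] := eqVneq t 0; first by rewrite subr0 powRr1 ?(ltW NR)// powRr0 mul1r mulr1.
  by rewrite powR0// mul0r mulr0.
have {sn} sp : 0 < s by rewrite lt_neqAle eq_sym sn.
have c0 : 0 < s / N%:R by rewrite divr_gt0.
have vE i : v i = s / N%:R * (v i / (s / N%:R)).
  by rewrite mulrC divfK// gt_eqF.
under eq_bigr => i _.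
  rewrite vE powRM; [|exact: ltW|by rewrite divr_ge0// ltW].
  over.
rewrite -mulr_sumr.
have -> : N%:R `^ (1 - t) * s `^ t = (s / N%:R) `^ t * N%:R.
  rewrite powRM ?invr_ge0 ?(ltW NR)// powRB ?(gt_eqF NR) ?implybT//.
  by rewrite powRr1 ?(ltW NR)// -[N%:R^-1]powR_inv1 ?(ltW NR)// -powRrM mulN1r powRN; ring.
rewrite ler_wpM2l ?powR_ge0//.
apply: (@le_trans _ _ (\sum_(i < N) (t * (v i / (s / N%:R)) + (1 - t)))).
  apply: ler_sum => i _; apply: powR_le_affine; first by rewrite t0.
  by rewrite divr_ge0// ltW.
rewrite big_split/= -mulr_sumr -mulr_suml -/s sumr_const card_ord.
have -> : s / (s / N%:R) = N%:R.
  by rewrite invf_div mulrCA mulfV ?mulr1// (gt_eqF sp).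
by rewrite -[(1 - t) *+ N]mulr_natr; lra.
Qed.

Lemma sqr_powR (x : R) t : 0 <= x -> (x ^+ 2) `^ t = x `^ (2 * t).
Proof. by move=> x0; rewrite -powR_mulrn// powRrM. Qed.

Lemma sum_powR_le_l2norm q u : 1 <= q <= 2 -> (0 < N)%N ->
  \sum_i `|u i| `^ q <= N%:R `^ (1 - q / 2) * l2norm u `^ q.
Proof.
move=> /andP[q1 q2] N0.
have := @sum_powR_le (q / 2) (fun i => u i ^+ 2).
rewrite -sqr_l2norm sqr_powR ?l2norm_ge0// (_ : 2 * (q / 2) = q); last by lra.
move=> h; apply: le_trans (h _ N0 _) => [|//|i]; last exact: sqr_ge0.
  apply: ler_sum => i _; rewrite -[u i ^+ 2]real_normK ?num_real// sqr_powR//.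
  by rewrite (_ : 2 * (q / 2) = q)//; lra.
by lra.
Qed.

(** Cauchy-Schwarz, then Jensen for the exponent [q - 1 <= 1]. *)
Lemma sum_mul_powR_le_l2norm q h g : 1 <= q <= 2 -> (0 < N)%N ->
  \sum_i `|h i| * `|g i| `^ (q - 1) <=
    N%:R `^ (1 - q / 2) * (l2norm h * l2norm g `^ (q - 1)).
Proof.
move=> /andP[q1 q2] N0.
apply: (le_trans (sum_mul_le_l2norm _ _)).
rewrite l2norm_normr mulrCA ler_wpM2l ?l2norm_ge0//.
rewrite -ler_sqr ?nnegrE ?l2norm_ge0 ?mulr_ge0 ?powR_ge0// sqr_l2norm.
have := @sum_powR_le (q - 1) (fun i => g i ^+ 2).
rewrite -(sqr_l2norm g) sqr_powR ?l2norm_ge0// => h'.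
apply: le_trans (le_trans (h' _ N0 _) _) => [|||].
- apply: ler_sum => i _; rewrite -[g i ^+ 2]real_normK ?num_real// sqr_powR//.
  by rewrite -powR_mulrn ?powR_ge0// -powRrM mulrC.
- by lra.
- by move=> i; rewrite sqr_ge0.
rewrite exprMn -!powR_mulrn ?powR_ge0// -!powRrM.
rewrite (_ : (1 - q / 2) * 2 = 1 - (q - 1)) ?[_ * 2]mulrC//; lra.
Qed.

End euclidean_norm.

(** * Expectations controlled by tails *)

Section layers.
Local Open Scope ereal_scope.
Context {d'} {S : measurableType d'} {R : realType} (P : probability S R).

Lemma measurable_set_ltr (f g : S -> R) :
  measurable_fun setT f -> measurable_fun setT g ->
  measurable [set w | (f w < g w)%R].
Proof.
move=> mf mg; rewrite (_ : [set _ | _] = ~` [set w | (g w <= f w)%R]).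
  by apply: measurableC; rewrite -[X in measurable X]setTI; exact: measurable_fun_le.
by apply/seteqP; split=> w /=; rewrite ltNge => /negP.
Qed.

(** The events [E k] need not be disjoint: charging [c k] on each of them
    overestimates [phi], and only the masses of the [E k] enter the bound. *)
Lemma integral_le_layers (phi : S -> \bar R) (E : nat -> set S)
    (c : nat -> R) (M : R) :
  measurable_fun setT phi -> (forall w, 0 <= phi w) ->
  (forall k, measurable (E k)) -> (forall k, (0 <= c k)%R) -> (0 <= M)%R ->
  {ae P, forall w, exists k, E k w /\ phi w <= (c k)%:E} ->
  (forall k, (c k)%:E * P (E k) <= (M / (2 ^ k.+1)%:R)%:E) ->
  \int[P]_w phi w <= M%:E.
Proof.
move=> mphi phi0 mE c0 M0 cover cE.
have g0 k w : 0 <= (c k * \1_(E k) w)%:E by rewrite lee_fin mulr_ge0.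
have mg k : measurable_fun setT (fun w => (c k * \1_(E k) w)%:E).
  apply/measurable_EFinP; apply: measurable_funM => //.
apply: (@le_trans _ _ (\int[P]_w \sum_(0 <= k <oo) (c k * \1_(E k) w)%:E)).
  apply: ae_ge0_le_integral => //.
  - by move=> w _; exact: nneseries_ge0.
  - exact: ge0_emeasurable_sum.
  - apply: filterS cover => w [k [Ek hk]] _; apply: (le_trans hk).
    apply: (@le_trans _ _ (c k * \1_(E k) w)%:E).
      by rewrite indicE mem_set// mulr1.
    apply: le_trans (nneseries_lim_ge k.+1 _) => //.
    by rewrite big_nat_recr//= leeDr// sume_ge0.
rewrite integral_nneseries//.
apply: le_trans (epsilon_trick0 xpredT M0).
apply: lee_nneseries => [k _ _|k _]; first exact: integral_ge0.
apply: le_trans (cE k).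
under eq_integral do rewrite EFinM.
by rewrite ge0_integralZl ?integral_indic ?setIT// ?lee_fin//; exact/measurable_EFinP.
Qed.

(** Where [g ^+ 2 / (2 * s ^+ 2)] lies between [k] and [k + 1], the exponential
    is at most [expR (k + 1)], on an event of mass at most [C * expR (- 2 * k)]. *)
Lemma subgaussian_exp_moment (g : S -> R) (C s : R) :
  (0 <= C)%R -> (0 < s)%R -> measurable_fun setT g ->
  (forall u, (0 < u)%R ->
    P [set w | (u <= `|g w|)%R] <= (C * expR (- (u ^+ 2 / s ^+ 2)))%:E) ->
  \int[P]_w (expR (g w ^+ 2 / (2 * s ^+ 2)))%:E <=
    (2 * (expR 1 * (1 + C)))%:E.
Proof.
move=> C0 s0 mg tail.
pose V w : R := (g w ^+ 2 / (2 * s ^+ 2))%R.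
have s20 : (0 < 2 * s ^+ 2)%R by rewrite mulr_gt0// exprn_gt0.
have V0 w : (0 <= V w)%R by rewrite /V divr_ge0 ?sqr_ge0// ltW.
have mV : measurable_fun setT V.
  by apply: measurable_funM => //; exact: measurable_funX.
pose E k := [set w | (k%:R <= V w)%R].
have mE k : measurable (E k).
  by rewrite /E -[X in measurable X]setTI; apply: measurable_fun_le.
have PE k : P (E k) <= ((1 + C) * expR (- (2 * k%:R)))%:E.
  case: k => [|k].
    apply: (@le_trans _ _ 1); first exact: probability_le1.
    by rewrite mulr0 oppr0 expR0 mulr1 lee_fin lerDl.
  pose u : R := (Num.sqrt (2 * k.+1%:R) * s)%R.
  have u0 : (0 < u)%R by rewrite mulr_gt0// sqrtr_gt0 mulr_gt0.
  have u2 : (u ^+ 2 / s ^+ 2 = 2 * k.+1%:R)%R.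
    by rewrite /u exprMn sqr_sqrtr ?mulr_ge0// mulfK// gt_eqF// exprn_gt0.
  have -> : E k.+1 = [set w | (u <= `|g w|)%R].
    apply/seteqP; split => w /=; rewrite /E/= /V -(ler_sqr (x := u)) ?nnegrE ?(ltW u0)//.
      rewrite real_normK ?num_real// ler_pdivlMr// => h.
      by move: u2 => /(congr1 (fun x => x * s ^+ 2)%R); rewrite divfK ?gt_eqF ?exprn_gt0//; lra.
    rewrite real_normK ?num_real// ler_pdivlMr// => h.
    by move: u2 => /(congr1 (fun x => x * s ^+ 2)%R); rewrite divfK ?gt_eqF ?exprn_gt0//; lra.
  apply: (le_trans (tail _ u0)); rewrite u2 lee_fin ler_wpM2r ?expR_ge0//; lra.
apply: (@integral_le_layers _ E (fun k => expR k.+1%:R)) => //.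
- by apply/measurable_EFinP; exact: measurableT_comp.
- by rewrite !mulr_ge0 ?expR_ge0//; lra.
- apply: aeW => w; exists (Num.truncn (V w)).
  have /andP[h1 h2] := Num.Theory.truncn_itv (V0 w).
  by split=> //; rewrite lee_fin ler_expR ltW.
- move=> k; apply: (le_trans (lee_wpmul2l _ (PE k))).
    by rewrite lee_fin expR_ge0.
  rewrite -EFinM lee_fin ler_pdivlMr ?ltr0n ?expn_gt0// expnS natrM.
  have -> : (expR k.+1%:R * ((1 + C) * expR (- (2 * k%:R))) * (2 * (2 ^ k)%:R) =
     2 * (expR 1 * (1 + C)) * ((2 ^ k)%:R / expR k%:R))%R.
    have -> : (expR (- (2 * k%:R)) = (expR k%:R)^-1 * (expR k%:R)^-1 :> R)%R.
      by rewrite -expRN -expRD; congr expR; ring.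
    rewrite -natr1 expRD; field; exact: lt0r_neq0 (expR_gt0 _).
  rewrite ler_piMr ?mulr_ge0 ?expR_ge0//; first lra.
  by rewrite ler_pdivrMr ?expR_gt0// mul1r pow2_le_expR.
Qed.

End layers.

(** * Independence and the Chernoff bound *)

Section independence.
Import HBNNSimple.
Local Open Scope ereal_scope.
Context {d d'} {T : measurableType d} {S : measurableType d'} {R : realType}.
Variable P : probability S R.

Lemma integral_indic_comp (X : {RV P >-> T}) (B : set T) : measurable B ->
  \int[P]_w (\1_B (X w))%:E = P (X @^-1` B).
Proof.
move=> mB; rewrite -[X @^-1` B]setIT -integral_indic//.
by rewrite -[_ @^-1` _]setTI; exact: measurable_funP.
Qed.

(** The two sides, as functions of [g], are integrals; both are additive and
    continuous along increasing sequences, so agreement on indicators passes to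
    simple functions and then to monotone limits. *)
Lemma integral_mul_comp (X : {RV P >-> T}) (W : S -> R) (c : R) (g : T -> R) :
  measurable_fun setT W -> (forall w, (0 <= W w)%R) -> (0 <= c)%R ->
  measurable_fun setT g -> (forall t, (0 <= g t)%R) ->
  (forall B, measurable B ->
    \int[P]_w (W w * \1_B (X w))%:E = c%:E * P (X @^-1` B)) ->
  \int[P]_w (W w * g (X w))%:E = c%:E * \int[P]_w (g (X w))%:E.
Proof.
move=> mW W0 c0 mg g0 hB.
have mX : measurable_fun setT X by [].
have simple (h : {nnsfun T >-> R}) :
    \int[P]_w (W w * h (X w))%:E = c%:E * \int[P]_w (h (X w))%:E.
  have hE w : (W w * h (X w))%:E =
      \sum_(y \in range h) (W w * (y * \1_(h @^-1` [set y]) (X w)))%:E.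
    by rewrite fimfunE mulr_fsumr// fsumEFin.
  have hE' w : (h (X w))%:E =
      \sum_(y \in range h) (y * \1_(h @^-1` [set y]) (X w))%:E.
    by rewrite fimfunE fsumEFin.
  have y0 y t : (0 <= y * \1_(h @^-1` [set y]) t)%R.
    rewrite indicE; have [|] := boolP (t \in _); last by rewrite mulr0.
    by rewrite inE/= mulr1 => <-.
  have m1 y : measurable_fun setT (fun w => (y * \1_(h @^-1` [set y]) (X w))%R).
    by apply: measurable_funM => //; apply: measurableT_comp.
  under eq_integral do rewrite hE.
  rewrite ge0_integral_fsum//; last 2 first.
  - by move=> y; apply/measurable_EFinP; exact: measurable_funM.
  - by move=> y w _; rewrite lee_fin mulr_ge0.
  under [in RHS]eq_integral do rewrite hE'.
  rewrite ge0_integral_fsum//; last 2 first.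
  - by move=> y; exact/measurable_EFinP.
  - by move=> y w _; rewrite lee_fin.
  rewrite ge0_mule_fsumr; last by move=> y; apply: integral_ge0 => w _; rewrite lee_fin.
  apply: eq_fsbigr => y /[!inE] -[t _ <-].
  have ht : (0 <= h t)%R by [].
  under eq_integral do rewrite mulrCA EFinM.
  rewrite ge0_integralZl//; last 2 first.
  - by apply/measurable_EFinP; apply: measurable_funM => //; exact: measurableT_comp.
  - by move=> w _; rewrite lee_fin mulr_ge0.
  rewrite hB//.
  under [in RHS]eq_integral do rewrite EFinM.
  rewrite ge0_integralZl//; last first.
    by apply/measurable_EFinP; exact: measurableT_comp.
  rewrite muleCA; congr (_ * (_ * _)).
  by rewrite integral_indic_comp.
have mg' : measurable_fun setT (EFin \o g) by exact/measurable_EFinP.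
pose h := nnsfun_approx measurableT mg'.
have cvgh t : (h n t)%:E @[n --> \oo] --> (g t)%:E.
  by apply: cvg_nnsfun_approx => // u _; rewrite lee_fin.
have ndh t m n : (m <= n)%N -> (h m t <= h n t)%R.
  by move=> mn; apply/lefP/nd_nnsfun_approx.
have mhX n : measurable_fun setT (fun w => h n (X w)).
  by apply: measurableT_comp.
have L : (\int[P]_w (W w * h n (X w))%:E) @[n --> \oo] -->
    \int[P]_w (W w * g (X w))%:E.
  rewrite (_ : \int[P]_w _ =
      \int[P]_w limn (fun n => (W w * h n (X w))%:E)).
    apply: cvg_monotone_convergence => //.
    - by move=> n; apply/measurable_EFinP; exact: measurable_funM.
    - by move=> n w _; rewrite lee_fin mulr_ge0.
    - by move=> w _ m n mn; rewrite lee_fin ler_wpM2l// ndh.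
  apply: eq_integral => w _; apply/esym/cvg_lim => //.
  under eq_fun do rewrite EFinM.
  by rewrite EFinM; apply: cvgeZl => //.
have L' : (\int[P]_w (h n (X w))%:E) @[n --> \oo] --> \int[P]_w (g (X w))%:E.
  rewrite (_ : \int[P]_w _ = \int[P]_w limn (fun n => (h n (X w))%:E)).
    apply: cvg_monotone_convergence => //.
    - by move=> n; exact/measurable_EFinP.
    - by move=> n w _; rewrite lee_fin.
    - by move=> w _ m n mn; rewrite lee_fin ndh.
  by apply: eq_integral => w _; apply/esym/cvg_lim.
have L'' : (c%:E * \int[P]_w (h n (X w))%:E) @[n --> \oo] -->
    c%:E * \int[P]_w (g (X w))%:E by exact: cvgeZl.
rewrite -(cvg_lim (@ereal_hausdorff R) L) -(cvg_lim (@ereal_hausdorff R) L'').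
have e : (fun n => \int[P]_w (W w * h n (X w))%:E) =
    (fun n => c%:E * \int[P]_w (h n (X w))%:E).
  by apply/funext => n; exact: simple.
by rewrite e.
Qed.

(** Independence is the case [k = 0], where all the [g i] are indicators.  The
    step from [k] to [k + 1] frees the function of index [k] by
    [integral_mul_comp], with [W] the product of the other factors. *)
Lemma integral_prod_independent_rec (N : nat) (Xs : 'I_N -> {RV P >-> T}) (k : nat) :
  mutually_independent Xs -> (k <= N)%N ->
  forall g : 'I_N -> T -> R,
  (forall i, measurable_fun setT (g i)) -> (forall i t, (0 <= g i t)%R) ->
  (forall i, \int[P]_w (g i (Xs i w))%:E \is a fin_num) ->
  (forall i : 'I_N, (k <= i)%N -> exists2 B, measurable B & g i = \1_B) ->
  \int[P]_w (\prod_(i < N) g i (Xs i w))%:E =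
    \prod_(i < N) \int[P]_w (g i (Xs i w))%:E.
Proof.
move=> indep; elim: k => [_ g mg g0 fg gB|k IH kN g mg g0 fg gB].
  have /choice[B HB] i : exists B, measurable B /\ g i = \1_B.
    by have [B mB gE] := gB i (leq0n _); exists B.
  have mB i : measurable (B i) by case: (HB i).
  under [in RHS]eq_bigr => i _.
    rewrite (proj2 (HB i)) integral_indic_comp//; over.
  rewrite -indep//.
  have mI : measurable [set w | forall i, B i (Xs i w)].
    rewrite (_ : [set _ | _] = \bigcap_(i in setT) (Xs i @^-1` B i)).
      apply: fin_bigcap_measurable => // i _.
      by rewrite -[_ @^-1` _]setTI; exact: measurable_funP.
    by apply/seteqP; split=> w /= h i; [move=> _|]; exact: h.
  have PE (A : set S) : measurable A -> P A = \int[P]_w (\1_A w)%:E.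
    by move=> mA; rewrite integral_indic ?setIT.
  rewrite (PE _ mI).
  apply: eq_integral => w _.
  congr EFin; rewrite indicE; have [h|/negP h] := boolP (w \in _).
    apply: big1 => i _; rewrite (proj2 (HB i)) indicE mem_set//.
    by move: h; rewrite inE => /(_ i).
  have [i Hi] : exists i, ~ B i (Xs i w).
    by apply/existsNP => hh; apply: h; rewrite inE.
  by rewrite (bigD1 i)//= (proj2 (HB i)) indicE memNset// mul0r.
pose j := Ordinal kN.
pose W w : R := (\prod_(i < N | i != j) g i (Xs i w))%R.
pose c : \bar R := \prod_(i < N | i != j) \int[P]_w (g i (Xs i w))%:E.
have i0 i : 0 <= \int[P]_w (g i (Xs i w))%:E.
  by apply: integral_ge0 => w _; rewrite lee_fin.
have c0 : 0 <= c by apply: prode_ge0.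
have cf : c \is a fin_num by apply: prode_fin_num.
under eq_integral do rewrite (bigD1 j)//= mulrC.
rewrite [RHS](bigD1 j)//= muleC -/c -(fineK cf).
apply: (@integral_mul_comp (Xs j) W) => //.
- rewrite /W; under eq_fun do rewrite -big_filter.
  by apply: measurable_prod => i _; exact: measurableT_comp.
- by move=> w; apply: prodr_ge0.
- by rewrite fine_ge0.
move=> B mB.
pose g' i := if i == j then \1_B else g i.
have g'j : g' j = \1_B by rewrite /g' eqxx.
have g'i i : i != j -> g' i = g i by rewrite /g' => /negbTE ->.
transitivity (\int[P]_w (\prod_(i < N) g' i (Xs i w))%:E).
  apply: eq_integral => w _; congr EFin.
  rewrite [RHS](bigD1 j)//= g'j [RHS]mulrC; congr *%R.
  by apply: eq_bigr => i ij; rewrite g'i.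
rewrite (IH (ltnW kN) g').
- rewrite (bigD1 j)//= g'j integral_indic_comp// muleC fineK//; congr *%E.
  by apply: eq_bigr => i ij; rewrite g'i.
- by move=> i; rewrite /g'; case: ifP.
- by move=> i t; rewrite /g'; case: ifP.
- move=> i; rewrite /g'; case: ifP => // _; rewrite integral_indic_comp//.
  rewrite fin_num_measure// -[_ @^-1` _]setTI; exact: measurable_funP.
- move=> i ki; rewrite /g'; case: eqP => [_|/eqP ij]; first by exists B.
  apply: gB; rewrite ltn_neqAle ki andbT; apply: contraNneq ij => ij.
  by apply/eqP/val_inj.
Qed.

Lemma integral_prod_independent (N : nat) (Xs : 'I_N -> {RV P >-> T})
    (g : 'I_N -> T -> R) :
  mutually_independent Xs ->
  (forall i, measurable_fun setT (g i)) -> (forall i t, (0 <= g i t)%R) ->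
  (forall i, \int[P]_w (g i (Xs i w))%:E \is a fin_num) ->
  \int[P]_w (\prod_(i < N) g i (Xs i w))%:E =
    \prod_(i < N) \int[P]_w (g i (Xs i w))%:E.
Proof.
move=> indep mg g0 fg.
apply: (@integral_prod_independent_rec N Xs N indep (leqnn _)) => // i.
by rewrite leqNgt ltn_ord.
Qed.

Lemma integral_eq_distribution (X Y : {RV P >-> T}) (g : T -> \bar R) :
  (forall A, measurable A -> distribution P X A = distribution P Y A) ->
  measurable_fun setT g -> (forall t, 0 <= g t) ->
  \int[P]_w g (X w) = \int[P]_w g (Y w).
Proof.
move=> XY mg g0.
rewrite -[LHS](ge0_integral_distribution X mg g0).
rewrite -[RHS](ge0_integral_distribution Y mg g0).
by apply: eq_measure_integral => A mA _; exact: XY.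
Qed.

(** Cramer-Chernoff: Markov's inequality for [expR (\sum_i phi (Xs i))], whose
    expectation factors. *)
Lemma chernoff_iid (N : nat) (Xs : 'I_N -> {RV P >-> T}) (X : {RV P >-> T})
    (phi : T -> R) (a t : R) :
  mutually_independent Xs ->
  (forall i A, measurable A -> distribution P (Xs i) A = distribution P X A) ->
  measurable_fun setT phi ->
  \int[P]_w (expR (phi (X w)))%:E <= (expR a)%:E ->
  P [set w | (N%:R * a + t < \sum_(i < N) phi (Xs i w))%R] <= (expR (- t))%:E.
Proof.
move=> indep iid mphi ha.
pose V w : R := (\sum_(i < N) phi (Xs i w))%R.
have mV : measurable_fun setT V.
  by apply: measurable_sum => i; exact: measurableT_comp.
have meV : measurable_fun setT (fun w => expR (V w)) by exact: measurableT_comp.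
have me : measurable_fun setT (fun x => (expR (phi x))%:E).
  by apply/measurable_EFinP; exact: measurableT_comp.
have hi i : \int[P]_w (expR (phi (Xs i w)))%:E <= (expR a)%:E.
  rewrite (@integral_eq_distribution (Xs i) X (fun x => (expR (phi x))%:E))//.
  exact: iid.
have hi0 i : 0 <= \int[P]_w (expR (phi (Xs i w)))%:E.
  by apply: integral_ge0 => w _; rewrite lee_fin expR_ge0.
have EV : \int[P]_w (expR (V w))%:E <= (expR (N%:R * a))%:E.
  under eq_integral do rewrite expR_sum.
  rewrite (@integral_prod_independent N Xs (fun _ x => expR (phi x)))//.
  - apply: (@le_trans _ _ (\prod_(i < N) (expR a)%:E)).
      suff : 0 <= \prod_(i < N) \int[P]_w (expR (phi (Xs i w)))%:E <=
        \prod_(i < N) (expR a)%:E by case/andP.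
      apply: (big_rec2 (fun x y => 0 <= x <= y)) => [|i x y _ /andP[x0 xy]].
        by rewrite lee01 lexx.
      by rewrite mule_ge0//= lee_pmul.
    by rewrite prodEFin prodr_const card_ord expRM_natl.
  - by move=> i; exact: measurableT_comp.
  - by move=> i; rewrite ge0_fin_numE// (le_lt_trans (hi i))// ltry.
set E := [set w | _].
have mE : measurable E.
  by apply: measurable_set_ltr.
have h : (expR (N%:R * a + t))%:E * P E <= (expR (N%:R * a))%:E.
  apply: le_trans EV.
  rewrite -[in P E](setIT E) -integral_indic// -ge0_integralZl//; last first.
    exact/measurable_EFinP.
  apply: ge0_le_integral => //.
  - by apply/measurable_EFinP; apply: measurable_funM.
  - exact/measurable_EFinP.
  - move=> w _; rewrite -EFinM lee_fin indicE.
    have [|_] := boolP (w \in E); last by rewrite mulr0 expR_ge0.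
    by rewrite inE/= mulr1 ler_expR => /ltW.
move: h; rewrite -(fineK (fin_num_measure P E mE)) -EFinM !lee_fin.
by rewrite addrC !expRD expRN -ler_pdivlMl ?mulr_gt0 ?expR_gt0// invfM mulfVK// gt_eqF ?expR_gt0.
Qed.

End independence.

(** * Concentration of sums *)

Section concentration.
Local Open Scope ereal_scope.
Context {d d'} {T : measurableType d} {S : measurableType d'} {R : realType}.
Variable P : probability S R.

Lemma measurable_l2norm (N : nat) (u : 'I_N -> S -> R) :
  (forall i, measurable_fun setT (u i)) ->
  measurable_fun setT (fun w => l2norm (fun i => u i w)).
Proof.
move=> mu; apply: (measurableT_comp (continuous_measurable_fun (@sqrt_continuous R))).
by apply: measurable_sum => i; exact: measurable_funX.
Qed.

Lemma ge0_integrable_le (f : S -> R) (M : R) : measurable_fun setT f ->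
  \int[P]_w (`|f w|)%:E <= M%:E -> P.-integrable setT (EFin \o f).
Proof.
move=> mf h; apply/integrableP; split; first exact/measurable_EFinP.
by apply: le_lt_trans (ltry M).
Qed.

Lemma exp_integrable (Y : S -> R) (D : R) : measurable_fun setT Y ->
  \int[P]_w (expR `|Y w|)%:E <= D%:E -> P.-integrable setT (EFin \o Y).
Proof.
move=> mY h; apply: (@ge0_integrable_le _ D) => //; apply: le_trans h.
apply: ge0_le_integral => //.
- by apply/measurable_EFinP; exact: measurableT_comp.
- apply/measurable_EFinP; apply: measurableT_comp => //; exact: measurableT_comp.
- by move=> w _; rewrite lee_fin; have := expR_ge1Dx `|Y w|; lra.
Qed.

(** The linear term of the exponential integrates to the mean; the quadratic
    remainder is absorbed by the exponential moment. *)
Lemma centered_exp_moment (Y : S -> R) (D l : R) : measurable_fun setT Y ->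
  (`|l| <= 1 / 2)%R ->
  \int[P]_w (expR `|Y w|)%:E <= D%:E ->
  \int[P]_w (expR (l * Y w))%:E <=
    (expR (l * fine (\int[P]_w (Y w)%:E) + 16 * l ^+ 2 * D))%:E.
Proof.
move=> mY l2 hD.
have mE : measurable_fun setT (fun w => expR `|Y w|).
  by apply: measurableT_comp => //; exact: measurableT_comp.
have iY : P.-integrable setT (fun w => (Y w)%:E) by exact: exp_integrable hD.
have iE : P.-integrable setT (fun w => (expR `|Y w|)%:E).
  apply: (@ge0_integrable_le _ D) => //.
  by under eq_integral do rewrite ger0_norm ?expR_ge0//.
set m := fine _.
have mE' : \int[P]_w (Y w)%:E = m%:E.
  by rewrite fineK// integrable_fin_num.
have [M ME] : exists M : R, \int[P]_w (expR `|Y w|)%:E = M%:E.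
  by exists (fine (\int[P]_w (expR `|Y w|)%:E)); rewrite fineK// integrable_fin_num.
have MD : (M <= D)%R by rewrite -lee_fin -ME.
have pt w : (expR (l * Y w) <= 1 + l * Y w + 16 * l ^+ 2 * expR `|Y w|)%R.
  apply: le_trans (expR_le_quadratic _) _; rewrite lerD2l exprMn normrM.
  have h : (expR (`|l| * `|Y w|) <= expR (`|Y w| / 2))%R.
    by rewrite ler_expR mulrC ler_wpM2l//; lra.
  have := sqr_expR_le (normr_ge0 (Y w)); rewrite real_normK ?num_real// => h2.
  have h3 : (Y w ^+ 2 * expR (`|l| * `|Y w|) <= 16 * expR `|Y w|)%R.
    by apply: le_trans h2; rewrite ler_wpM2l// sqr_ge0.
  by have := ler_wpM2l (sqr_ge0 l) h3; lra.
apply: (@le_trans _ _ (\int[P]_w (1 + l * Y w + 16 * l ^+ 2 * expR `|Y w|)%:E)).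
  apply: ge0_le_integral => //.
  - apply/measurable_EFinP; apply: measurableT_comp => //; exact: measurable_funM.
  - apply/measurable_EFinP; apply: measurable_funD.
      by apply: measurable_funD => //; exact: measurable_funM.
    exact: measurable_funM.
  - by move=> w _; rewrite lee_fin pt.
have i1 : P.-integrable setT (fun w => (1 + l * Y w)%:E).
  under eq_fun do rewrite EFinD EFinM.
  apply: integrableD => //.
    by apply: finite_measure_integrable_cst.
  exact: integrableZl.
under eq_integral do rewrite EFinD.
rewrite integralD//=; last first.
  by under eq_fun do rewrite EFinM; exact: integrableZl.
under eq_integral do rewrite EFinD.
rewrite integralD//=; last 2 first.
- exact: finite_measure_integrable_cst.
- by under eq_fun do rewrite EFinM; exact: integrableZl.
under [X in _ + X + _]eq_integral do rewrite EFinM.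
under [X in _ + _ + X]eq_integral do rewrite EFinM.
have I1 : \int[P]_(w in setT) (1%:E : \bar R) = 1%:E.
  by rewrite integral_cst//= mul1e; exact: probability_setT.
rewrite !integralZl// mE' ME I1.
rewrite -!EFinM -!EFinD lee_fin.
apply: le_trans (expR_ge1Dx _); rewrite -addrA lerD2l lerD2l.
by rewrite ler_wpM2l// mulr_ge0// sqr_ge0.
Qed.

Section iid.
Context {N : nat} {Xs : 'I_N -> {RV P >-> T}} {X : {RV P >-> T}}.
Hypothesis N0 : (0 < N)%N.
Hypothesis indep : mutually_independent Xs.
Hypothesis iid : forall i A, measurable A ->
  distribution P (Xs i) A = distribution P X A.

(** Chernoff's bound at parameter [sqrt (t / N) / 10], which stays below [1 / 2]
    as long as [t <= 25 * N]: in this range the deviation is sub-Gaussian. *)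
Lemma bernstein_upper (Y : T -> R) (D t : R) : measurable_fun setT Y ->
  (0 < t <= 25 * N%:R)%R -> (0 <= D)%R ->
  \int[P]_w (expR `|Y (X w)|)%:E <= D%:E ->
  P [set w | ((2 * D + 10) * Num.sqrt (t * N%:R) <
     \sum_(i < N) Y (Xs i w) - N%:R * fine (\int[P]_w (Y (X w))%:E))%R]
    <= (expR (- t))%:E.
Proof.
move=> mY /andP[t0 tN] D0 hD; set m := fine _.
have NR : (0 < N%:R :> R)%R by rewrite ltr0n.
set r := Num.sqrt (t * N%:R).
have r0 : (0 < r)%R by rewrite sqrtr_gt0 mulr_gt0.
have r2 : (r ^+ 2 = t * N%:R)%R by rewrite sqr_sqrtr// mulr_ge0// ltW.
have rN : (r <= 5 * N%:R)%R.
  rewrite -ler_sqr ?nnegrE ?(ltW r0) ?mulr_ge0 ?(ltW NR)// r2.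
  by have := ler_wpM2r (ltW NR) tN; rewrite exprMn; lra.
pose l : R := (r / (10 * N%:R))%R.
have l0 : (0 < l)%R by rewrite divr_gt0// mulr_gt0.
have l2 : (`|l| <= 1 / 2)%R.
  rewrite gtr0_norm// ler_pdivrMr ?mulr_gt0//; lra.
have mYX : measurable_fun setT (fun w => Y (X w)) by exact: measurableT_comp.
have := centered_exp_moment mYX l2 hD; rewrite -/m.
move=> /(@chernoff_iid _ _ _ _ _ P N Xs X (fun x => l * Y x)%R _ t indep iid).
move=> /(_ (measurable_funM (measurable_cst l) mY)); apply: le_trans.
have mS : measurable_fun setT (fun w => (\sum_(i < N) Y (Xs i w))%R).
  by apply: measurable_sum => i; exact: measurableT_comp.
apply: le_measure; rewrite ?inE.
- by apply: measurable_set_ltr => //; apply: measurable_funB.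
- apply: measurable_set_ltr => //; apply: measurable_sum => i.
  by apply: measurable_funM => //; exact: measurableT_comp.
move=> w /=; rewrite -mulr_sumr; set s := (\sum_i _)%R => h.
have lN : (l * N%:R = r / 10)%R.
  by rewrite /l; field; rewrite gt_eqF.
have lr : (l * r = t / 10)%R.
  rewrite /l mulrAC -expr2 r2; field; rewrite gt_eqF//.
have {}h : (l * ((2 * D + 10) * r) < l * (s - N%:R * m))%R by rewrite ltr_pM2l.
have e1 : (l * ((2 * D + 10) * r) = (2 * D + 10) * (t / 10))%R.
  by rewrite mulrCA lr.
have e2 : (N%:R * (l * m + 16 * l ^+ 2 * D) = l * (N%:R * m) + 16 * D * (t / 100))%R.
  have -> : (t / 100 = (l * r) / 10)%R by rewrite lr; field.
  have -> : (l * r / 10 = l * (l * N%:R))%R by rewrite lN; ring.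
  ring.
rewrite e2; move: h; rewrite e1 mulrBr; nra.
Qed.

Lemma bernstein (Y : T -> R) (K D t : R) : measurable_fun setT Y ->
  (0 < K)%R -> (0 < t <= 25 * N%:R)%R -> (0 <= D)%R ->
  \int[P]_w (expR (`|Y (X w)| / K))%:E <= D%:E ->
  P [set w | ((2 * D + 10) * K * Num.sqrt (t * N%:R) <
     `|\sum_(i < N) Y (Xs i w) - N%:R * fine (\int[P]_w (Y (X w))%:E)|)%R]
    <= (2 * expR (- t))%:E.
Proof.
move=> mY K0 ht D0 hD.
have mYX : measurable_fun setT (fun w => Y (X w)) by exact: measurableT_comp.
pose Y1 x : R := (K^-1 * Y x)%R; pose Y2 x : R := (- K^-1 * Y x)%R.
have mY1 : measurable_fun setT Y1 by exact: measurable_funM.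
have mY2 : measurable_fun setT Y2 by exact: measurable_funM.
have Ki : (0 < K^-1)%R by rewrite invr_gt0.
have hD1 : \int[P]_w (expR `|Y1 (X w)|)%:E <= D%:E.
  by under eq_integral do rewrite normrM (gtr0_norm Ki) mulrC.
have hD2 : \int[P]_w (expR `|Y2 (X w)|)%:E <= D%:E.
  by under eq_integral do rewrite normrM normrN (gtr0_norm Ki) mulrC.
have iY1 := exp_integrable (measurableT_comp mY1 (measurable_funP X)) hD1.
set m := fine _.
have iY : P.-integrable setT (fun w => (Y (X w))%:E).
  rewrite (_ : (fun _ => _) = (fun w => K%:E * (Y1 (X w))%:E)).
    exact: integrableZl.
  by apply/funext => w; rewrite -EFinM mulrA mulfV ?mul1r// gt_eqF.
have E1 : fine (\int[P]_w (Y1 (X w))%:E) = (K^-1 * m)%R.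
  under eq_integral do rewrite EFinM.
  by rewrite integralZl// fineM// integrable_fin_num.
have E2 : fine (\int[P]_w (Y2 (X w))%:E) = (- K^-1 * m)%R.
  under eq_integral do rewrite EFinM.
  by rewrite integralZl// fineM// integrable_fin_num.
have h1 := bernstein_upper mY1 ht D0 hD1.
have h2 := bernstein_upper mY2 ht D0 hD2.
rewrite E1 in h1; rewrite E2 in h2.
set A1 := [set w | _] in h1; set A2 := [set w | _] in h2.
have mS (Z : T -> R) : measurable_fun setT Z ->
    measurable_fun setT (fun w => (\sum_(i < N) Z (Xs i w))%R).
  by move=> mZ; apply: measurable_sum => i; exact: measurableT_comp.
have mA1 : measurable A1.
  by apply: measurable_set_ltr => //; apply: measurable_funB => //; exact: mS.
have mA2 : measurable A2.
  by apply: measurable_set_ltr => //; apply: measurable_funB => //; exact: mS.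
apply: (@le_trans _ _ (P (A1 `|` A2))).
  apply: le_measure; rewrite ?inE.
  - apply: measurable_set_ltr => //; apply: measurableT_comp => //.
    by apply: measurable_funB => //; exact: mS.
  - exact: measurableU.
  move=> w /=; rewrite /A1 /A2/= /Y1 /Y2 -!mulr_sumr.
  set s := (\sum_i _)%R; set r := Num.sqrt _ => h.
  have [s0|s0] := leP 0%R (s - N%:R * m)%R.
    left; move: h; rewrite ger0_norm// mulrCA -mulrBr ltr_pdivlMl//.
    by rewrite mulrA (mulrC K).
  right; move: h; rewrite ltr0_norm// mulrCA -mulrBr mulNr -mulrN ltr_pdivlMl//.
  by rewrite mulrA (mulrC K).
apply: (le_trans (measureU2 P mA1 mA2)).
have -> : (2 * expR (- t))%:E = (expR (- t))%:E + (expR (- t))%:E.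
  by rewrite -EFinD; congr EFin; ring.
exact: leeD.
Qed.

(** Chernoff's bound for [g ^+ 2 / (2 * s ^+ 2)]; the constant [2 * D] covers
    [ln D] because [ln D <= D <= D ^+ 2]. *)
Lemma sum_sqr_tail (g : T -> R) (s D t : R) : measurable_fun setT g ->
  (0 < s)%R -> (1 <= D)%R -> (0 <= t)%R ->
  \int[P]_w (expR (g (X w) ^+ 2 / (2 * s ^+ 2)))%:E <= D%:E ->
  P [set w | (2 * D * s * Num.sqrt (N%:R + t) < l2norm (fun i => g (Xs i w)))%R]
    <= (expR (- t))%:E.
Proof.
move=> mg s0 D1 t0 hD.
have D0 : (0 < D)%R by exact: lt_le_trans D1.
have mg2 : measurable_fun setT (fun x => (g x ^+ 2 / (2 * s ^+ 2))%R).
  by apply: measurable_funM => //; exact: measurable_funX.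
have := @chernoff_iid _ _ _ _ _ P N Xs X _ (ln D) t indep iid mg2.
rewrite lnK ?posrE// => /(_ hD); apply: le_trans.
have mS : measurable_fun setT (fun w => (\sum_(i < N) g (Xs i w) ^+ 2)%R).
  apply: measurable_sum => i; apply: measurable_funX; exact: measurableT_comp.
apply: le_measure; rewrite ?inE.
- apply: measurable_set_ltr => //.
  by apply: measurable_l2norm => i; exact: measurableT_comp.
- apply: measurable_set_ltr => //; apply: measurable_sum => i.
  by apply: (measurableT_comp mg2).
move=> w /= h; rewrite -mulr_suml ltr_pdivlMr ?mulr_gt0 ?exprn_gt0//.
have NR : (0 <= N%:R :> R)%R by [].
rewrite -sqr_l2norm; move: h; rewrite -ltr_sqr ?nnegrE ?l2norm_ge0 ?mulr_ge0 ?sqrtr_ge0 ?(ltW D0) ?(ltW s0)//.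
apply: le_lt_trans; rewrite !exprMn sqr_sqrtr ?addr_ge0//.
have lD : (ln D <= D)%R by have := @ln_sublinear R D D0; lra.
have : (N%:R * ln D + t <= 2 * D ^+ 2 * (N%:R + t))%R.
  have : (D <= D ^+ 2)%R by rewrite expr2; nra.
  have : (N%:R * ln D <= N%:R * D)%R by rewrite ler_wpM2l.
  nra.
have : (0 <= s ^+ 2)%R by rewrite sqr_ge0.
nra.
Qed.

End iid.
End concentration.

(** * Tails of the increments over the class *)

Section power_increment.
Context {R : realType}.

Lemma expR_add3_le (x y z : R) :
  expR (x + y + z) <= expR (3 * x) + expR (3 * y) + expR (3 * z).
Proof.
have x0 := expR_ge0 (3 * x); have y0 := expR_ge0 (3 * y).
have z0 := expR_ge0 (3 * z).
have [h|[h|h]] : x + y + z <= 3 * x \/ x + y + z <= 3 * y \/ x + y + z <= 3 * z.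
  have [xy|xy] := leP x y; have [yz|yz] := leP y z; have [xz|xz] := leP x z; lra.
all: by rewrite -ler_expR in h; lra.
Qed.

(** Dividing by the scales [s] and [De] leaves
    [2 * u * (v `^ (q - 1) + w `^ (q - 1))], which is at most
    [2 + 4 * u ^+ 2 + v ^+ 2 + w ^+ 2] because [v `^ (q - 1) <= 1 + v]; the
    exponential of a sum of three terms is at most the sum of the exponentials
    of their triples. *)
Lemma expR_power_increment_le (q x y s De : R) : 1 <= q <= 2 -> 0 < s -> 0 < De ->
  expR (`| `|x| `^ q - `|y| `^ q | / (24 * s * De `^ (q - 1))) <=
    expR 1 * (expR ((x - y) ^+ 2 / (2 * s ^+ 2)) +
              expR (x ^+ 2 / (2 * De ^+ 2)) + expR (y ^+ 2 / (2 * De ^+ 2))).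
Proof.
move=> q12 s0 De0; have /andP[q1 q2] := q12.
pose u := `|x - y| / s; pose v := `|x| / De; pose w := `|y| / De.
have u0 : 0 <= u by rewrite divr_ge0// ltW.
have v0 : 0 <= v by rewrite divr_ge0// ltW.
have w0 : 0 <= w by rewrite divr_ge0// ltW.
have uE : (x - y) ^+ 2 / (2 * s ^+ 2) = u ^+ 2 / 2.
  by rewrite /u exprMn real_normK ?num_real// exprVn; field; rewrite gt_eqF.
have vE : x ^+ 2 / (2 * De ^+ 2) = v ^+ 2 / 2.
  by rewrite /v exprMn real_normK ?num_real// exprVn; field; rewrite gt_eqF.
have wE : y ^+ 2 / (2 * De ^+ 2) = w ^+ 2 / 2.
  by rewrite /w exprMn real_normK ?num_real// exprVn; field; rewrite gt_eqF.
rewrite uE vE wE.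
have P0 : 0 < De `^ (q - 1) by exact: powR_gt0.
have pw z : `|z| `^ (q - 1) <= De `^ (q - 1) * (1 + `|z| / De).
  have -> : `|z| `^ (q - 1) = De `^ (q - 1) * (`|z| / De) `^ (q - 1).
    rewrite -powRM ?divr_ge0// ?(ltW De0)//; congr powR.
    by field; rewrite gt_eqF.
  rewrite ler_wpM2l ?(ltW P0)//.
  have z0 : 0 <= `|z| / De by rewrite divr_ge0// ltW.
  have := @powR_le_affine R (`|z| / De) (q - 1) ltac:(lra) z0; nra.
have bd : `| `|x| `^ q - `|y| `^ q | / (24 * s * De `^ (q - 1)) <=
    1 + (u ^+ 2 / 6 + v ^+ 2 / 6 + w ^+ 2 / 6).
  rewrite ler_pdivrMr ?mulr_gt0//.
  apply: (le_trans (powR_norm_sub_le _ _ q12)).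
  have xyE : `|x - y| = s * u by rewrite /u; field; rewrite gt_eqF.
  rewrite xyE; apply: (@le_trans _ _
    (2 * (s * u) * (De `^ (q - 1) * (1 + v) + De `^ (q - 1) * (1 + w)))).
    apply: ler_wpM2l; first by have := mulr_ge0 (ltW s0) u0; lra.
    by apply: lerD; exact: pw.
  rewrite (_ : 2 * (s * u) * _ =
    (s * De `^ (q - 1)) * (2 * u * (2 + v + w))); last by ring.
  rewrite (_ : _ * (24 * _ * _) = (s * De `^ (q - 1)) *
    (24 + 4 * u ^+ 2 + 4 * v ^+ 2 + 4 * w ^+ 2)); last by field.
  rewrite ler_wpM2l ?mulr_ge0 ?(ltW s0) ?(ltW P0)//.
  have := sqr_ge0 (u - v); have := sqr_ge0 (u - w); have := sqr_ge0 (u - 1).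
  rewrite !sqrrB; have := sqr_ge0 u; have := sqr_ge0 v; have := sqr_ge0 w.
  rewrite expr1n; lra.
apply: (@le_trans _ _ (expR (1 + (u ^+ 2 / 6 + v ^+ 2 / 6 + w ^+ 2 / 6)))).
  by rewrite ler_expR.
rewrite expRD ler_wpM2l ?expR_ge0//.
apply: (le_trans (expR_add3_le _ _ _)).
rewrite (_ : 3 * (u ^+ 2 / 6) = u ^+ 2 / 2); last by field.
rewrite (_ : 3 * (v ^+ 2 / 6) = v ^+ 2 / 2); last by field.
by rewrite (_ : 3 * (w ^+ 2 / 6) = w ^+ 2 / 2)//; field.
Qed.

End power_increment.

(** Bounds for [E (expR ((h / s) ^+ 2 / 2))] over the increments [h] of the class,
    and for [E (expR (`|Y| / K))] over the increments [Y] of the [q]-th powers, at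
    the natural scales [s] and [K]. *)
Definition psi2_const {R : realType} (C1 : R) : R := 2 * (expR 1 * (1 + C1)).
Definition psi1_const {R : realType} (C1 : R) : R := 3 * expR 1 * psi2_const C1.

Definition abs_moment d d' (T : measurableType d) (S : measurableType d')
    (R : realType) (P : probability S R) (X : {RV P >-> T}) (q : R)
    (a : T -> R) : R :=
  fine (\int[P]_w (`|a (X w)| `^ q)%:E).

Section class.
Local Open Scope ereal_scope.
Context {d d'} {T : measurableType d} {S : measurableType d'} {R : realType}.
Context {P : probability S R} {X : {RV P >-> T}} {F : set (T -> R)}.
Context {rho : (T -> R) -> (T -> R) -> R} {C1 q De : R} {N : nat}.
Context {Xs : 'I_N -> {RV P >-> T}}.
Hypothesis C11 : (1 < C1)%R.
Hypothesis q12 : (1 <= q <= 2)%R.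
Hypothesis mF : forall f, F f -> measurable_fun setT f.
Hypothesis F0 : F (fun _ => 0%R).
Hypothesis dist : is_distance F rho.
Hypothesis subg : subgaussian_increments X F C1 rho.
Hypothesis De0 : (0 < De)%R.
Hypothesis rhoDe : forall f g, F f -> F g -> (rho f g <= De)%R.
Hypothesis N0 : (0 < N)%N.
Hypothesis indep : mutually_independent Xs.
Hypothesis iid : forall i A, measurable A ->
  distribution P (Xs i) A = distribution P X A.

Lemma psi2_const_ge1 : (1 <= (psi2_const C1))%R.
Proof. by have := @expR_ge1Dx R 1; rewrite /psi2_const; have := C11; nra. Qed.

Lemma psi1_const_ge1 : (1 <= (psi1_const C1))%R.
Proof.
by have := @expR_ge1Dx R 1; rewrite /psi1_const; have := psi2_const_ge1; nra.
Qed.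

Lemma dist_ge0 a b : F a -> F b -> (0 <= rho a b)%R.
Proof. by case: dist => h _ _ _; exact: h. Qed.

Lemma dist_eq0 a b : F a -> F b -> rho a b = 0%R -> a = b.
Proof. by case: dist => _ h _ _ Fa Fb /(h _ _ Fa Fb). Qed.

Lemma increment_exp_moment a b (s : R) : F a -> F b -> (0 < s)%R ->
  (rho a b <= s)%R ->
  \int[P]_w (expR ((a (X w) - b (X w)) ^+ 2 / (2 * s ^+ 2)))%:E <= (psi2_const C1)%:E.
Proof.
move=> Fa Fb s0 abs; apply: subgaussian_exp_moment => //.
- by have := C11; lra.
- by apply: measurable_funB; apply: measurableT_comp => //; exact: mF.
move=> u u0; have [r0|rn] := eqVneq (rho a b) 0%R.
  rewrite (dist_eq0 Fa Fb r0) (_ : [set _ | _] = set0).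
    by rewrite measure0 lee_fin mulr_ge0 ?expR_ge0//; have := C11; lra.
  by apply/seteqP; split=> w //=; rewrite subrr normr0; lra.
apply: (le_trans (subg Fa Fb u0)); rewrite lee_fin.
rewrite ler_wpM2l//; first by have := C11; lra.
rewrite ler_expR lerN2 ler_wpM2l ?sqr_ge0//.
have rp : (0 < rho a b)%R by rewrite lt_neqAle eq_sym rn dist_ge0.
by rewrite lef_pV2 ?posrE ?exprn_gt0// ler_pXn2r ?nnegrE ?(ltW s0) ?(ltW rp).
Qed.

Let pw (a : T -> R) (t : T) : R := (`|a t| `^ q)%R.

Let mpw a : F a -> measurable_fun setT (pw a).
Proof.
move=> Fa; apply: (measurableT_comp (measurable_powR _)) => //.
by apply: measurableT_comp => //; exact: mF.
Qed.

Let mX (g : T -> R) : measurable_fun setT g -> measurable_fun setT (fun w => g (X w)).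
Proof. by move=> mg; exact: measurableT_comp. Qed.

Lemma power_increment_exp_moment a b (s : R) : F a -> F b -> (0 < s)%R ->
  (rho a b <= s)%R ->
  \int[P]_w (expR (`| `|a (X w)| `^ q - `|b (X w)| `^ q | /
      (24 * s * De `^ (q - 1))))%:E <= (psi1_const C1)%:E.
Proof.
move=> Fa Fb s0 abs.
have h0 := increment_exp_moment Fa Fb s0 abs.
have h1 := increment_exp_moment Fa F0 De0 (rhoDe Fa F0).
have h2 := increment_exp_moment Fb F0 De0 (rhoDe Fb F0).
pose U w := expR ((a (X w) - b (X w)) ^+ 2 / (2 * s ^+ 2)).
pose V w := expR ((a (X w) - 0) ^+ 2 / (2 * De ^+ 2)).
pose W w := expR ((b (X w) - 0) ^+ 2 / (2 * De ^+ 2)).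
have mexp (g : T -> R) (c : R) : measurable_fun setT g ->
    measurable_fun setT (fun w => expR (g (X w) ^+ 2 / c)).
  move=> mg; apply: measurableT_comp => //; apply: measurable_funM => //.
  by apply: measurable_funX; exact: measurableT_comp.
have mU : measurable_fun setT U.
  by apply: (mexp (fun t => a t - b t)%R); apply: measurable_funB; exact: mF.
have mV : measurable_fun setT V.
  by apply: (mexp (fun t => a t - 0)%R); apply: measurable_funB => //; exact: mF.
have mW : measurable_fun setT W.
  by apply: (mexp (fun t => b t - 0)%R); apply: measurable_funB => //; exact: mF.
have U0 w : (0 <= U w)%R by exact: expR_ge0.
have V0 w : (0 <= V w)%R by exact: expR_ge0.
have W0 w : (0 <= W w)%R by exact: expR_ge0.
apply: (@le_trans _ _ (\int[P]_w ((expR 1)%:E * ((U w)%:E + (V w)%:E + (W w)%:E)))).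
  apply: ge0_le_integral => //.
  - apply/measurable_EFinP; apply: measurableT_comp => //.
    apply: measurable_funM => //; apply: measurableT_comp => //.
    by apply: measurable_funB; [exact: (mX (mpw Fa))|exact: (mX (mpw Fb))].
  - apply: emeasurable_funM => //; apply: emeasurable_funD.
      by apply: emeasurable_funD; exact/measurable_EFinP.
    exact/measurable_EFinP.
  - move=> w _; rewrite -!EFinD -EFinM lee_fin /U /V /W !subr0.
    exact: expR_power_increment_le.
rewrite ge0_integralZl//; last 2 first.
- apply: emeasurable_funD; last exact/measurable_EFinP.
  by apply: emeasurable_funD; exact/measurable_EFinP.
- by move=> w _; rewrite !adde_ge0// lee_fin.
have EP f : (forall w, (0 <= f w)%R) -> forall w, [set: S] w -> 0 <= (f w)%:E.
  by move=> f0 w _; rewrite lee_fin.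
have -> : \int[P]_x ((U x)%:E + (V x)%:E + (W x)%:E) =
    \int[P]_x ((U x)%:E + (V x)%:E) + \int[P]_x (W x)%:E.
  apply: ge0_integralD => //; try exact: EP; try exact/measurable_EFinP.
    by move=> w _; rewrite adde_ge0// lee_fin.
  by apply: emeasurable_funD; exact/measurable_EFinP.
have -> : \int[P]_x ((U x)%:E + (V x)%:E) =
    \int[P]_x (U x)%:E + \int[P]_x (V x)%:E.
  by apply: ge0_integralD => //; try exact: EP; exact/measurable_EFinP.
apply: (@le_trans _ _ ((expR 1)%:E * ((psi2_const C1)%:E + (psi2_const C1)%:E + (psi2_const C1)%:E))).
  apply: lee_wpmul2l; first by rewrite lee_fin expR_ge0.
  by apply: leeD; [apply: leeD; [exact: h0|exact: h1]|exact: h2].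
by rewrite -!EFinD -EFinM lee_fin /psi1_const; lra.
Qed.

Lemma power_integrable a : F a ->
  P.-integrable setT (fun w => (`|a (X w)| `^ q)%:E).
Proof.
move=> Fa.
have := power_increment_exp_moment Fa F0 De0 (rhoDe Fa F0).
set K := (_ * _ * _)%R => h.
have K0 : (0 < K)%R by rewrite !mulr_gt0// powR_gt0.
have q0 : q != 0%R by rewrite gt_eqF//; have /andP[] := q12; lra.
have mY : measurable_fun setT (fun w => (K^-1 * pw a (X w))%R).
  by apply: measurable_funM => //; apply: mX; exact: mpw.
have iY : P.-integrable setT (fun w => (K^-1 * pw a (X w))%:E).
  apply: (exp_integrable mY); apply: le_trans h.
  under eq_integral do rewrite normrM gtr0_norm ?invr_gt0//.
  under [leRHS]eq_integral do rewrite normr0 powR0// subr0 mulrC.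
  by [].
rewrite (_ : (fun _ => _) = (fun w => K%:E * (K^-1 * pw a (X w))%:E)).
  exact: integrableZl.
by apply/funext => w; rewrite -EFinM mulrA mulfV ?mul1r// gt_eqF.
Qed.

Lemma integral_power_increment a b : F a -> F b ->
  fine (\int[P]_w (`|a (X w)| `^ q - `|b (X w)| `^ q)%:E) =
    (abs_moment X q a - abs_moment X q b)%R.
Proof.
move=> Fa Fb; under eq_integral do rewrite EFinB.
by rewrite integralB ?power_integrable// fineB// integrable_fin_num// power_integrable.
Qed.

(** [`|Y| <= K * expR (`|Y| / K)]. *)
Lemma abs_moment_increment a b : F a -> F b ->
  (`|abs_moment X q a - abs_moment X q b| <=
    24 * (psi1_const C1) * De `^ (q - 1) * rho a b)%R.
Proof.
move=> Fa Fb; have [r0|rn] := eqVneq (rho a b) 0%R.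
  by rewrite r0 mulr0 (dist_eq0 Fa Fb r0) subrr normr0.
have rp : (0 < rho a b)%R by rewrite lt_neqAle eq_sym rn dist_ge0.
have := power_increment_exp_moment Fa Fb rp (lexx _).
set K := (_ * _ * _)%R => h.
have K0 : (0 < K)%R by rewrite !mulr_gt0// powR_gt0.
rewrite -integral_power_increment//.
have mY : measurable_fun setT (fun w => (pw a (X w) - pw b (X w))%R).
  by apply: measurable_funB; apply: mX; exact: mpw.
have iY : P.-integrable setT (fun w => (pw a (X w) - pw b (X w))%:E).
  by under eq_fun do rewrite EFinB; apply: integrableB => //; exact: power_integrable.
rewrite -lee_fin; set I := \int[P]_w _.
have -> : (`|fine I|%R)%:E = `|I|.
  by rewrite -[in RHS](@fineK _ I)// integrable_fin_num.
apply: (le_trans (le_abse_integral _ _ _)) => //.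
  exact/measurable_EFinP.
apply: (@le_trans _ _ (\int[P]_w (K%:E *
    (expR (`|pw a (X w) - pw b (X w)| / K))%:E))).
  apply: ge0_le_integral => //.
  - by apply: measurableT_comp => //; exact/measurable_EFinP.
  - apply/measurable_EFinP; apply: measurable_funM => //.
    apply: measurableT_comp => //; apply: measurable_funM => //.
    exact: measurableT_comp.
  - move=> w _; rewrite -EFinM lee_fin -ler_pdivrMl// mulrC.
    by apply: le_trans (expR_ge1Dx _); lra.
rewrite ge0_integralZl_EFin//; last 2 first.
- by apply/measurable_EFinP; apply: measurableT_comp => //;
    apply: measurable_funM => //; exact: measurableT_comp.
- exact: ltW.
apply: (@le_trans _ _ (K%:E * (psi1_const C1)%:E)).
  by rewrite lee_wpmul2l// lee_fin ltW.
by rewrite -EFinM lee_fin /K; lra.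
Qed.

Lemma increment_tail a b t : F a -> F b -> (0 <= t)%R ->
  P [set w | (2 * (psi2_const C1) * rho a b * Num.sqrt (N%:R + t) <
      l2norm (fun i => (a (Xs i w) - b (Xs i w))))%R] <= (expR (- t))%:E.
Proof.
move=> Fa Fb t0; have [r0|rn] := eqVneq (rho a b) 0%R.
  rewrite (_ : [set _ | _] = set0) ?measure0 ?lee_fin ?expR_ge0//.
  apply/seteqP; split=> w //=; rewrite r0 (dist_eq0 Fa Fb r0) mulr0 mul0r.
  rewrite /l2norm; under eq_bigr do rewrite subrr expr0n.
  by rewrite big1// sqrtr0 ltxx.
have rp : (0 < rho a b)%R by rewrite lt_neqAle eq_sym rn dist_ge0.
apply: (sum_sqr_tail indep iid (g := (fun t => a t - b t)%R)) => //.
- by apply: measurable_funB; exact: mF.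
- exact: psi2_const_ge1.
- exact: increment_exp_moment.
Qed.

Lemma power_increment_tail a b t : F a -> F b -> (0 < t <= 25 * N%:R)%R ->
  P [set w | ((2 * (psi1_const C1) + 10) * (24 * rho a b * De `^ (q - 1)) *
        Num.sqrt (t * N%:R) <
      `| \sum_(i < N) (`|a (Xs i w)| `^ q - `|b (Xs i w)| `^ q)
         - N%:R * (abs_moment X q a - abs_moment X q b)|)%R] <= (2 * expR (- t))%:E.
Proof.
move=> Fa Fb t0; have [r0|rn] := eqVneq (rho a b) 0%R.
  rewrite (_ : [set _ | _] = set0) ?measure0 ?lee_fin ?mulr_ge0 ?expR_ge0//.
  apply/seteqP; split=> w //=; rewrite r0 (dist_eq0 Fa Fb r0) mulr0 !mul0r mulr0 mul0r.
  by rewrite subrr mulr0 subr0 big1 ?normr0 ?ltxx// => i _; rewrite subrr.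
have rp : (0 < rho a b)%R by rewrite lt_neqAle eq_sym rn dist_ge0.
rewrite -integral_power_increment//.
apply: (bernstein N0 indep iid (Y := (fun t => pw a t - pw b t)%R)) => //.
- by apply: measurable_funB; exact: mpw.
- by rewrite !mulr_gt0// powR_gt0.
- exact: le_trans psi1_const_ge1.
- exact: power_increment_exp_moment.
Qed.

End class.

(** * Union over the levels of an admissible sequence *)

Section union_bound.
Local Open Scope ereal_scope.
Context {d'} {S : measurableType d'} {R : realType} (P : probability S R).

Lemma enum_card_le (U : Type) (A : set U) (m : nat) (z : U) :
  (A #<= `I_m)%card ->
  exists e : nat -> U, (forall i, A (e i) \/ e i = z) /\
    forall a, A a \/ a = z -> exists2 i, (i < m.+1)%N & e i = a.
Proof.
move=> /pcard_leP/unsquash f.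
have ex i : exists a, (A a \/ a = z) /\ (forall b, A b -> f b = i -> b = a).
  have [[b [Ab fb]]|h] := pselect (exists b, A b /\ f b = i).
    exists b; split; first by left.
    have fi : {in A &, injective f} by exact: inj.
    by move=> c Ac fc; apply: fi; [exact: mem_set|exact: mem_set|rewrite fc fb].
  by exists z; split; [right|move=> b Ab fb; case: h; exists b].
have [e he] := choice ex.
exists (fun i => if i is i'.+1 then e i' else z); split.
  by case=> [|i]; [right|case: (he i)].
move=> a [Aa|->]; last by exists 0%N.
exists (f a).+1.
  have : `I_m (f a) by exact: funS.
  by rewrite /= ltnS.
by have [_ h] := he (f a); rewrite -(h a).
Qed.

(** The pairs of points of the level [n.+1], enlarged by one point. *)
Lemma level_cardinality n :
  (((2 ^ 2 ^ n.+1).+1 ^ 2)%:R <= 4 * expR (4 * (2 ^ n)%:R) :> R)%R.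
Proof.
apply: (@le_trans _ _ (4 * 2 ^ (4 * 2 ^ n))%:R).
  rewrite ler_nat (_ : 4 * _ = (2 * 2 ^ (2 ^ n.+1)) ^ 2)%N.
    by rewrite leq_exp2r// mul2n -addnn -addn1 leq_add2l expn_gt0.
  by rewrite expnMn -expnM; congr (_ * 2 ^ _)%N; rewrite expnS; lia.
rewrite natrM ler_wpM2l//; have := @pow2_le_expR R (4 * 2 ^ n).
by rewrite natrM.
Qed.

Lemma measure_pairs_le (B : nat -> nat -> set S) (m : nat) (c : R) : (0 <= c)%R ->
  (forall i j, measurable (B i j)) -> (forall i j, P (B i j) <= c%:E) ->
  P (\big[setU/set0]_(i < m) \big[setU/set0]_(j < m) B i j) <= ((m ^ 2)%:R * c)%:E.
Proof.
move=> c0 mB hB.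
apply: le_trans.
  apply: (@Boole_inequality _ _ _ P (fun i => \big[setU/set0]_(j < m) B i j)).
  by move=> i _; exact: bigsetU_measurable.
apply: (@le_trans _ _ (\sum_(i < m) (m%:R * c)%:E)).
  apply: lee_sum => i _; apply: le_trans.
    exact: (@Boole_inequality _ _ _ P (B i)).
  apply: (@le_trans _ _ (\sum_(j < m) c%:E)); first by apply: lee_sum => j _; exact: hB.
  by rewrite sumEFin sumr_const card_ord -[(c *+ m)%R]mulr_natl.
by rewrite sumEFin sumr_const card_ord -[(_ *+ m)%R]mulr_natl lee_fin mulrA -natrM.
Qed.

(** Level [k] has at most [4 * expR (4 * 2 ^ k)] pairs, so the exponent
    [10 * 2 ^ k] leaves [expR (- 6 * 2 ^ k)] per level; its sum over [k >= r] is
    governed by the first term since [2 ^ k >= 2 ^ r + (k - r)]. *)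
Lemma levels_good_event (U : Type) (F : set U) (A : nat -> set U)
    (Bad : nat -> U -> U -> set S) (r : nat) (x : R) (z : U) :
  F z -> (forall k, A k `<=` F) -> (forall k, (A k #<= `I_(2 ^ 2 ^ k)%N)%card) ->
  (forall k a b, F a -> F b -> measurable (Bad k a b)) ->
  (forall k a b, F a -> F b ->
    P (Bad k a b) <= (3 * expR (- (10 * (2 ^ k)%:R)))%:E) ->
  (x <= (2 ^ r)%:R)%R ->
  exists G : set S, [/\ measurable G, (1 - expR (- x))%:E <= P G &
    forall w, G w -> forall k, (r <= k)%N ->
    forall a b, A k.+1 a \/ a = z -> A k.+1 b \/ b = z -> ~ Bad k a b w].
Proof.
move=> Fz AF cA mB hB xr.
have /choice[e he] k := enum_card_le z (cA k.+1).
have Fe k i : F (e k i).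
  by have [[/AF//|->//] _] := ((he k).1 i, I).
pose M k := (2 ^ 2 ^ k.+1).+1.
pose L k := \big[setU/set0]_(i < M k) \big[setU/set0]_(j < M k) Bad k (e k i) (e k j).
have mL k : measurable (L k).
  by apply: bigsetU_measurable => i _; apply: bigsetU_measurable => j _; exact: mB.
have PL j : P (L (r + j)%N) <= (expR (- x) / (2 ^ j.+1)%:R)%:E.
  set k := (r + j)%N.
  apply: (le_trans (measure_pairs_le (B := fun i j => Bad k (e k i) (e k j))
    (c := (3 * expR (- (10 * (2 ^ k)%:R)))%R) (M k) _ _ _)) => //.
  - by move=> i i'; exact: mB.
  - by move=> i i'; exact: hB.
  rewrite lee_fin.
  apply: (@le_trans _ _ (4 * expR (4 * (2 ^ k)%:R) * (3 * expR (- (10 * (2 ^ k)%:R)))))%R.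
    by rewrite ler_wpM2r ?mulr_ge0 ?expR_ge0// level_cardinality.
  have k1 : (1 <= (2 ^ k)%:R :> R)%R by rewrite ler1n expn_gt0.
  have kx : (x + j%:R <= (2 ^ k)%:R :> R)%R.
    apply: (@le_trans _ _ ((2 ^ r)%:R + j%:R)%R); first by rewrite lerD2r.
    rewrite -natrD ler_nat /k expnD.
    have : (j < 2 ^ j)%N by exact: ltn_expl.
    have : (0 < 2 ^ r)%N by rewrite expn_gt0.
    by case: (2 ^ r)%N => // p _; case: (2 ^ j)%N => // p'; nia.
  have e5 : (24 <= expR 5 :> R)%R.
    have := @pow2_le_expR R 5; apply: le_trans; by rewrite ler_nat.
  have ej := @pow2_le_expR R j.
  rewrite ler_pdivlMr ?ltr0n ?expn_gt0//.
  apply: (@le_trans _ _ (expR (- x) * (12 * 2 * expR (- 5)) * ((2 ^ j)%:R * expR (- j%:R)))%R).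
    rewrite expnS natrM.
    rewrite (_ : _ * (3 * _) * _ = (4 * 3 * 2 * (2 ^ j)%:R) *
      (expR (4 * (2 ^ k)%:R) * expR (- (10 * (2 ^ k)%:R))))%R; last by ring.
    rewrite (_ : expR (- x) * _ * _ = (4 * 3 * 2 * (2 ^ j)%:R) *
      (expR (- x) * expR (- 5) * expR (- j%:R)))%R; last by ring.
    rewrite -!expRD ler_wpM2l ?mulr_ge0// ler_expR; lra.
  rewrite -mulrA ler_piMr ?expR_ge0// mulr_ile1 ?mulr_ge0 ?expR_ge0//.
    by rewrite expRN ler_pdivrMr ?expR_gt0//; lra.
  by rewrite expRN ler_pdivrMr ?expR_gt0// mul1r.
exists (~` \bigcup_j L (r + j)%N).
have mU : measurable (\bigcup_j L (r + j)%N) by exact: bigcup_measurable.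
have PU : P (\bigcup_j L (r + j)%N) <= (expR (- x))%:E.
  apply: le_trans (generalized_Boole_inequality _ _ _) _ => //.
  apply: le_trans (epsilon_trick0 xpredT (expR_ge0 (- x))).
  by apply: lee_nneseries => // j _; exact: PL.
split; first exact: measurableC.
- rewrite probability_setC// EFinB leeB//.
- move=> w Gw k rk a b Aa Ab hb; apply: Gw; exists (k - r)%N => //.
  rewrite subnKC//.
  have [i iM ei] := (he k).2 a Aa; have [j jM ej] := (he k).2 b Ab.
  have -> : L k = \bigcup_(i < M k) \bigcup_(j < M k) Bad k (e k i) (e k j).
    rewrite bigcup_mkord; apply: eq_bigr => i' _.
    by rewrite (bigcup_mkord (M k) (fun j => Bad k (e k i') (e k j))).
  by exists i => //; exists j => //; rewrite ei ej.
Qed.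

End union_bound.

(** * Chaining along nearest points *)

(** The weight [2 `^ (k / 2)] of the chaining functional, as a square root. *)
Definition level_weight {R : realType} (k : nat) : R := Num.sqrt (2 ^ k)%:R.

Definition chaining_const {R : realType} (c1 c2 c3 : R) : R :=
  600 * c2 ^+ 2 + 20 * c1 + c3.

Definition moment_bound {R : realType} (q De g x : R) (N : nat) : R :=
  g `^ q / N%:R `^ (q / 2) + De `^ (q - 1) * (g / Num.sqrt N%:R) +
  De `^ q * (Num.sqrt (x / N%:R) + (x / N%:R) `^ (q / 2)).

(** For one function and one outcome: [uf] and [mf] are the sample and the
    [q]-th absolute moment of the function, [u k] and [m k] those of its nearest
    point at the level [k], and [d k] is the distance to that point.  The levels
    [r] and [s] are those of the confidence level [x] and of the sample size [N],
    and [n] is the last level. *)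
Section chaining.
Context {R : realType} {N : nat}.
Variables (q De g c1 c2 c3 x mf : R) (uf : 'I_N -> R).
Variables (u : nat -> 'I_N -> R) (m d : nat -> R) (r s n : nat).
Hypothesis q12 : 1 <= q <= 2.
Hypothesis N0 : (0 < N)%N.
Hypothesis De0 : 0 < De.
Hypothesis g0 : 0 <= g.
Hypothesis c10 : 0 <= c1.
Hypothesis c21 : 1 <= c2.
Hypothesis c30 : 0 <= c3.
Hypothesis d0 : forall k, 0 <= d k.

Local Notation s2 := (@level_weight R).

Hypothesis sum_d : forall j, \sum_(k < j) s2 k * d k <= g.
Hypothesis step_l2 : forall k, (r <= k)%N ->
  l2norm (fun i => u k.+1 i - u k i) <=
    c2 * (d k + d k.+1) * Num.sqrt (N%:R + 10 * (2 ^ k)%:R).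
Hypothesis base_l2 : forall k, (r <= k)%N ->
  l2norm (u k) <= c2 * De * Num.sqrt (N%:R + 10 * (2 ^ k)%:R).
Hypothesis step_pow : forall k, (r <= k)%N -> (2 ^ k <= 2 * N)%N ->
  `| \sum_i (`|u k.+1 i| `^ q - `|u k i| `^ q) - N%:R * (m k.+1 - m k)| <=
    c1 * ((d k + d k.+1) * De `^ (q - 1)) * Num.sqrt (10 * (2 ^ k)%:R * N%:R).
Hypothesis base_pow : forall k, (r <= k)%N -> (2 ^ k <= 2 * N)%N ->
  `| \sum_i `|u k i| `^ q - N%:R * m k| <=
    c1 * (De * De `^ (q - 1)) * Num.sqrt (10 * (2 ^ k)%:R * N%:R).
Hypothesis mean_step : forall k, `|mf - m k| <= c3 * De `^ (q - 1) * d k.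
Hypothesis mean_base : `|mf| <= c3 * De `^ (q - 1) * De.
Hypothesis last_l2 :
  l2norm (fun i => uf i - u n i) <= c2 * d n * Num.sqrt (N%:R + 10 * (2 ^ n)%:R).
Hypothesis rn : (r <= n)%N.
Hypothesis sn : (s <= n)%N.
Hypothesis x1 : 1 <= x.
Hypothesis xr : x <= (2 ^ r)%:R <= 2 * x.
Hypothesis Ns : (N <= 2 ^ s <= 2 * N)%N.
Hypothesis s_min : forall k, (k < s)%N -> (2 ^ k <= N)%N.

Let NR : 0 < N%:R :> R. Proof. by rewrite ltr0n. Qed.
Let c20 : 0 <= c2. Proof. exact: le_trans c21. Qed.
Let s20 k : 0 < s2 k. Proof. by rewrite /level_weight sqrtr_gt0 ltr0n expn_gt0. Qed.

Let sum_steps j k : \sum_(j <= i < k) s2 i * (d i + d i.+1) <= 2 * g.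
Proof.
apply: (@le_trans _ _ (\sum_(0 <= i < k) s2 i * (d i + d i.+1))).
  have [jk|kj] := leqP j k.
    rewrite [leRHS](@big_cat_nat _ _ _ j)//= lerDr sumr_ge0// => i _.
    by rewrite mulr_ge0 ?(ltW (s20 _))// addr_ge0.
  rewrite big_geq; last exact: ltnW.
  by rewrite sumr_ge0// => i _; rewrite mulr_ge0 ?(ltW (s20 _))// addr_ge0.
rewrite big_mkord; under eq_bigr do rewrite mulrDr.
rewrite big_split/= mulrDl !mul1r; apply: lerD; first exact: sum_d.
apply: le_trans (sum_d k.+1); rewrite big_ord_recl.
apply: (@le_trans _ _ (\sum_(i < k) s2 i.+1 * d i.+1)).
  apply: ler_sum => i _; rewrite ler_wpM2r// /level_weight ler_sqrt ?ltr0n ?expn_gt0//.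
  by rewrite ler_nat leq_exp2l.
by rewrite lerDr mulr_ge0 ?(ltW (s20 _)).
Qed.

Let sum_d1 k : s2 k * d k <= g.
Proof.
apply: le_trans (sum_d k.+1); rewrite big_ord_recr/= lerDr sumr_ge0// => i _.
by rewrite mulr_ge0 ?(ltW (s20 _)).
Qed.

Let sqrt_level k : (N <= 2 ^ k)%N ->
  Num.sqrt (N%:R + 10 * (2 ^ k)%:R) <= 4 * s2 k.
Proof.
move=> Nk; have Nk' : (N%:R <= (2 ^ k)%:R :> R) by rewrite ler_nat.
apply: sqrtr_le_of_sqr; first by rewrite mulr_ge0 ?(ltW (s20 _)).
by rewrite exprMn /level_weight sqr_sqrtr//; have : 0 <= N%:R :> R by []; lra.
Qed.

(** The sum of the increments [d k + d k.+1], weighted, is at most [2 * g]; the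
    last step contributes one more [g], and [sqrt_level] the factor [4]. *)
Let tail_l2 j : (r <= j)%N -> (j <= n)%N -> (N <= 2 ^ j)%N ->
  l2norm (fun i => uf i - u j i) <= 12 * c2 * g.
Proof.
move=> rj jn Nj.
have Nk k : (j <= k)%N -> (N <= 2 ^ k)%N.
  by move=> jk; apply: (leq_trans Nj); rewrite leq_exp2l.
have tele k : (j <= k)%N -> l2norm (fun i => u k i - u j i) <=
    4 * c2 * \sum_(j <= i < k) s2 i * (d i + d i.+1).
  elim: k => [|k IH]; rewrite ?leqn0.
    move=> /eqP ->; rewrite big_geq// mulr0 /l2norm big1 ?sqrtr0// => i _.
    by rewrite subrr expr0n.
  rewrite leq_eqVlt => /predU1P[<-|]; last rewrite ltnS => jk.
    rewrite big_geq// mulr0 /l2norm big1 ?sqrtr0// => i _.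
    by rewrite subrr expr0n.
  rewrite big_nat_recr//= mulrDr.
  have -> : (fun i => u k.+1 i - u j i) =
      (fun i => (u k i - u j i) + (u k.+1 i - u k i)).
    by apply/funext => i; ring.
  apply: (le_trans (l2normD _ _)); rewrite lerD// ?IH//.
  apply: (le_trans (step_l2 (leq_trans rj jk))).
  rewrite (_ : 4 * c2 * _ = c2 * (d k + d k.+1) * (4 * s2 k)); last by ring.
  apply: ler_wpM2l; last exact: sqrt_level (Nk _ jk).
  by rewrite mulr_ge0 ?addr_ge0.
have -> : (fun i => uf i - u j i) = (fun i => (u n i - u j i) + (uf i - u n i)).
  by apply/funext => i; ring.
apply: (le_trans (l2normD _ _)).
have h1 := tele n jn.
have h2 : c2 * d n * Num.sqrt (N%:R + 10 * (2 ^ n)%:R) <= 4 * c2 * g.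
  apply: (@le_trans _ _ (c2 * d n * (4 * s2 n))).
    by apply: ler_wpM2l; [rewrite mulr_ge0|exact: sqrt_level (Nk _ jn)].
  rewrite (_ : _ * (4 * _) = 4 * c2 * (s2 n * d n)); last by ring.
  by apply: ler_wpM2l; [rewrite mulr_ge0|exact: sum_d1].
have h3 : 4 * c2 * \sum_(j <= i < n) s2 i * (d i + d i.+1) <= 4 * c2 * (2 * g).
  by apply: ler_wpM2l; [rewrite mulr_ge0|exact: sum_steps].
have := last_l2; lra.
Qed.

(** Here [2 ^ k <= N] for all the increments, so that [step_pow] applies. *)
Let middle_pow : (r <= s)%N ->
  `| (\sum_i `|u s i| `^ q - N%:R * m s) - (\sum_i `|u r i| `^ q - N%:R * m r)| <=
    8 * c1 * De `^ (q - 1) * g * Num.sqrt N%:R.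
Proof.
move=> rs; have P0 := powR_ge0 De (q - 1).
have tele k : (r <= k <= s)%N ->
    `| (\sum_i `|u k i| `^ q - N%:R * m k) - (\sum_i `|u r i| `^ q - N%:R * m r)| <=
    4 * c1 * De `^ (q - 1) * Num.sqrt N%:R * \sum_(r <= i < k) s2 i * (d i + d i.+1).
  elim: k => [|k IH]; rewrite ?leqn0.
    by move=> /andP[/eqP -> _]; rewrite big_geq// mulr0 subrr normr0.
  rewrite leq_eqVlt => /andP[/predU1P[<- _|]].
    by rewrite big_geq// mulr0 subrr normr0.
  rewrite ltnS => rk ks; rewrite big_nat_recr//= mulrDr.
  have {}IH := IH ltac:(by rewrite rk ltnW).
  have h := step_pow rk (leq_trans (s_min ks) (leq_pmull N (ltn0Sn 1))).
  rewrite sumrB in h.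
  rewrite (_ : _ - _ = (\sum_i `|u k i| `^ q - N%:R * m k -
      (\sum_i `|u r i| `^ q - N%:R * m r)) +
    (\sum_i `|u k.+1 i| `^ q - \sum_i `|u k i| `^ q - N%:R * (m k.+1 - m k)));
    last by ring.
  apply: (le_trans (ler_normD _ _)); apply: lerD => //; apply: (le_trans h).
  have -> : Num.sqrt (10 * (2 ^ k)%:R * N%:R) = Num.sqrt 10 * s2 k * Num.sqrt N%:R.
    by rewrite /level_weight !sqrtrM// mulr_ge0.
  have s10 : Num.sqrt 10 <= 4 :> R.
    by apply: sqrtr_le_of_sqr => //; rewrite -natrX ler_nat.
  rewrite (_ : c1 * _ * _ = Num.sqrt 10 * (c1 * De `^ (q - 1) * Num.sqrt N%:R *
    (s2 k * (d k + d k.+1)))); last by ring.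
  rewrite (_ : 4 * _ * _ * _ * _ = 4 * (c1 * De `^ (q - 1) * Num.sqrt N%:R *
    (s2 k * (d k + d k.+1)))); last by ring.
  by rewrite ler_wpM2r// !mulr_ge0 ?sqrtr_ge0 ?addr_ge0.
apply: (le_trans (tele s ltac:(by rewrite rs leqnn))).
rewrite (_ : 8 * _ * _ * _ * _ = 4 * c1 * De `^ (q - 1) * Num.sqrt N%:R * (2 * g));
  last by ring.
by rewrite ler_wpM2l ?sum_steps// !mulr_ge0 ?sqrtr_ge0.
Qed.

Let rt : R := Num.sqrt N%:R.
Let Q : R := N%:R `^ (q / 2).

Let rt0 : 0 < rt. Proof. by rewrite sqrtr_gt0. Qed.
Let rt2 : rt * rt = N%:R. Proof. by rewrite -expr2 sqr_sqrtr. Qed.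
Let Q0 : 0 < Q. Proof. exact: powR_gt0. Qed.

Let NQ : N%:R `^ (1 - q / 2) = N%:R / Q.
Proof. by rewrite powRB ?(gt_eqF NR) ?implybT// powRr1. Qed.

Let rtQ : rt `^ (q - 1) = Q / rt.
Proof.
have q0 : 0 < q by have /andP[] := q12; lra.
rewrite -[RHS]mulr1 -[X in _ = _ * X](@mulfV _ rt) ?gt_eqF//.
have -> : Q = rt * rt `^ (q - 1).
  by rewrite mulr_powRB1 ?(ltW rt0)// /Q -rt2 -expr2 sqr_powR ?(ltW rt0)//;
    congr powR; field.
by field; rewrite gt_eqF.
Qed.

Let const_ge : [/\ 288 * c2 ^+ 2 <= chaining_const c1 c2 c3,
  240 * c2 ^+ 2 + 8 * c1 + c3 <= chaining_const c1 c2 c3, 5 * c1 <= chaining_const c1 c2 c3 &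
  0 <= chaining_const c1 c2 c3].
Proof.
rewrite /chaining_const; have := sqr_ge0 c2; have := c10; have := c30.
by split; lra.
Qed.

Let DeM : De * De `^ (q - 1) = De `^ q.
Proof. by rewrite mulr_powRB1// ?(ltW De0)//; have /andP[] := q12; lra. Qed.

Let powR_scale (c : R) : 1 <= c -> c `^ q <= c ^+ 2.
Proof.
move=> c1'; rewrite -powR_mulrn; last lra.
by rewrite ler_powR//; have /andP[] := q12; lra.
Qed.

Let head_term : (12 * c2 * g) `^ q <= 144 * c2 ^+ 2 * g `^ q.
Proof.
rewrite powRM ?mulr_ge0//; apply: ler_wpM2r; first exact: powR_ge0.
have h1 : 1 <= 12 * c2 by have := c21; lra.
apply: (le_trans (powR_scale h1)).
by rewrite exprMn; lra.
Qed.

(** The deviation of [uf] splits into its distance to level [s] in the sample, the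
    chain from [r] to [s], the deviation at the level [r] and the difference of the
    moments of the function and of its nearest point at the level [s]. *)
Let chain_low : (r <= s)%N ->
  `| \sum_i `|uf i| `^ q - N%:R * mf| <= chaining_const c1 c2 c3 * N%:R * moment_bound q De g x N.
Proof.
move=> rs; have /andP[q1 q2] := q12; have c2_ge1 := c21; have x_ge1 := x1.
have /andP[Ns1 Ns2] := Ns; have /andP[xr1 xr2] := xr.
have P0 := powR_ge0 De (q - 1).
pose h : R := 12 * c2 * g; pose b : R := 5 * c2 * De * rt.
have h0 : 0 <= h by rewrite !mulr_ge0.
have b0 : 0 <= b by rewrite !mulr_ge0 ?(ltW De0) ?(ltW rt0).
have t1 : l2norm (fun i => uf i - u s i) <= h by exact: tail_l2.
have us : l2norm (u s) <= b.
  apply: (le_trans (base_l2 rs)).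
  rewrite (_ : b = c2 * De * (5 * rt)); last by rewrite /b; ring.
  apply: ler_wpM2l; first by rewrite mulr_ge0 ?(ltW De0).
  apply: sqrtr_le_of_sqr; first by rewrite mulr_ge0 ?(ltW rt0).
  rewrite exprMn sqr_sqrtr//.
  have : ((2 ^ s)%:R <= (2 * N)%:R :> R) by rewrite ler_nat.
  by rewrite natrM; have := NR; lra.
have uF : l2norm uf <= h + b.
  have -> : uf = (fun i => (uf i - u s i) + u s i) by apply/funext => i; ring.
  by apply: (le_trans (l2normD _ _)); exact: lerD.
have b1 : b `^ (q - 1) <= 5 * c2 * (De `^ (q - 1) * (Q / rt)).
  rewrite /b powRM ?(ltW rt0) ?mulr_ge0 ?(ltW De0)//.
  rewrite powRM ?mulr_ge0 ?(ltW De0)// rtQ -mulrA.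
  apply: ler_wpM2r; first by rewrite !mulr_ge0 ?invr_ge0 ?(ltW rt0) ?(ltW Q0).
  by apply: ler1_powR; lra.
have T1 : `| \sum_i `|uf i| `^ q - \sum_i `|u s i| `^ q| <=
    N%:R * (288 * c2 ^+ 2 * (g `^ q / Q) + 240 * c2 ^+ 2 * (De `^ (q - 1) * (g / rt))).
  rewrite -sumrB; apply: (le_trans (ler_norm_sum _ _ _)).
  apply: (@le_trans _ _ (\sum_i 2 * (`|uf i - u s i| * `|uf i| `^ (q - 1) +
      `|uf i - u s i| * `|u s i| `^ (q - 1)))).
    by apply: ler_sum => i _; rewrite -mulrDr mulrA; exact: powR_norm_sub_le.
  rewrite -mulr_sumr big_split/=.
  have e1 := sum_mul_powR_le_l2norm (fun i => uf i - u s i) uf q12 N0.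
  have e2 := sum_mul_powR_le_l2norm (fun i => uf i - u s i) (u s) q12 N0.
  rewrite NQ in e1 e2.
  have NQ0 : 0 <= N%:R / Q by rewrite divr_ge0// ltW.
  have f2 : l2norm (fun i => uf i - u s i) * l2norm (u s) `^ (q - 1) <= h * b `^ (q - 1).
    apply: ler_pM => //; rewrite ?l2norm_ge0 ?powR_ge0//.
    by rewrite ge0_ler_powR ?nnegrE ?l2norm_ge0//; lra.
  have f1 : l2norm (fun i => uf i - u s i) * l2norm uf `^ (q - 1) <=
      h * (h `^ (q - 1) + b `^ (q - 1)).
    apply: ler_pM => //; rewrite ?l2norm_ge0 ?powR_ge0//.
    have q01 : 0 <= q - 1 <= 1 by lra.
    apply: le_trans (powRD_le q01 h0 b0); have /andP[q10 _] := q01.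
    by apply: ge0_ler_powR => //; rewrite nnegrE ?l2norm_ge0 ?addr_ge0.
  have hh : h * h `^ (q - 1) <= 144 * c2 ^+ 2 * g `^ q.
    have q0 : 0 < q by lra.
    by rewrite mulr_powRB1//; exact: head_term.
  have hb := ler_wpM2l h0 b1.
  apply: (@le_trans _ _ (2 * (N%:R / Q * (144 * c2 ^+ 2 * g `^ q +
      2 * (h * (5 * c2 * (De `^ (q - 1) * (Q / rt)))))))).
    have := ler_wpM2l NQ0 f1; have := ler_wpM2l NQ0 f2.
    have := ler_wpM2l NQ0 hh; have := ler_wpM2l NQ0 hb.
    rewrite !mulrDr; lra.
  rewrite le_eqVlt; apply/orP; left; apply/eqP; rewrite /h; field.
  by rewrite !gt_eqF.
have T2 := middle_pow rs.
have T3 : `| \sum_i `|u r i| `^ q - N%:R * m r| <=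
    N%:R * (5 * c1 * (De `^ q * Num.sqrt (x / N%:R))).
  have rN : (2 ^ r <= 2 * N)%N.
    by apply: leq_trans Ns2; rewrite leq_exp2l.
  apply: (le_trans (base_pow (leqnn r) rN)); rewrite DeM.
  rewrite (_ : N%:R * _ = c1 * De `^ q * (5 * Num.sqrt (x / N%:R) * N%:R)); last by ring.
  apply: ler_wpM2l; first by rewrite mulr_ge0 ?powR_ge0.
  apply: sqrtr_le_of_sqr; first by rewrite !mulr_ge0 ?sqrtr_ge0.
  rewrite !exprMn sqr_sqrtr; last by rewrite divr_ge0//; lra.
  rewrite (_ : _ * N%:R ^+ 2 = 25 * x * N%:R); last by field; rewrite gt_eqF.
  by apply: ler_wpM2r => //; lra.
have T4 : N%:R * `|mf - m s| <= N%:R * (c3 * (De `^ (q - 1) * (g / rt))).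
  apply: ler_wpM2l => //; apply: (le_trans (mean_step s)); rewrite -mulrA.
  apply: ler_wpM2l => //; apply: ler_wpM2l => //.
  rewrite ler_pdivlMr//; apply: le_trans (sum_d1 s); rewrite mulrC.
  by apply: ler_wpM2r => //; rewrite ler_wsqrtr// ler_nat.
have T2' : 8 * c1 * De `^ (q - 1) * g * rt = N%:R * (8 * c1 * (De `^ (q - 1) * (g / rt))).
  by rewrite -rt2; field; rewrite gt_eqF.
rewrite -/rt T2' in T2.
rewrite (_ : _ - _ = (\sum_i `|uf i| `^ q - \sum_i `|u s i| `^ q) +
  ((\sum_i `|u s i| `^ q - N%:R * m s) - (\sum_i `|u r i| `^ q - N%:R * m r)) +
  (\sum_i `|u r i| `^ q - N%:R * m r) - N%:R * (mf - m s)); last by ring.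
apply: le_trans (ler_normB _ _) _; rewrite normrM (ger0_norm (ltW NR)).
apply: (le_trans (lerD (ler_normD _ _) T4)).
apply: (le_trans (lerD (lerD (ler_normD _ _) T3) (lexx _))).
apply: (le_trans (lerD (lerD (lerD T1 T2) (lexx _)) (lexx _))).
have a1 : 0 <= g `^ q / Q by rewrite divr_ge0 ?powR_ge0 ?(ltW Q0).
have a2 : 0 <= De `^ (q - 1) * (g / rt) by rewrite mulr_ge0 ?divr_ge0 ?(ltW rt0).
have a3 : 0 <= De `^ q * Num.sqrt (x / N%:R) by rewrite mulr_ge0 ?powR_ge0 ?sqrtr_ge0.
have a4 : 0 <= De `^ q * (x / N%:R) `^ (q / 2) by rewrite mulr_ge0 ?powR_ge0.
rewrite -!mulrDr (_ : chaining_const c1 c2 c3 * _ * _ =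
  N%:R * (chaining_const c1 c2 c3 * moment_bound q De g x N)); last by ring.
apply: ler_wpM2l => //.
have [k1 k2 k3 k4] := const_ge.
have := ler_wpM2r a1 k1; have := ler_wpM2r a2 k2; have := ler_wpM2r a3 k3.
have := mulr_ge0 k4 a4; rewrite /moment_bound -/rt -/Q; lra.
Qed.

(** When [2 ^ r] exceeds [2 ^ s] the confidence level dominates the sample size
    and no centring is needed: the moment [mf] is of the order of the last term,
    and the sum of the powers is bounded through the Euclidean norm alone. *)
Let chain_high : (s < r)%N ->
  `| \sum_i `|uf i| `^ q - N%:R * mf| <= chaining_const c1 c2 c3 * N%:R * moment_bound q De g x N.
Proof.
move=> sr; have /andP[q1 q2] := q12; have c2_ge1 := c21; have x_ge1 := x1.
have /andP[Ns1 Ns2] := Ns; have /andP[xr1 xr2] := xr.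
have P0 := powR_ge0 De (q - 1).
pose h : R := 12 * c2 * g; pose b : R := 5 * c2 * De * Num.sqrt x.
have h0 : 0 <= h by rewrite !mulr_ge0.
have b0 : 0 <= b by rewrite !mulr_ge0 ?(ltW De0) ?sqrtr_ge0.
have Nr : (2 * N <= 2 ^ r)%N.
  apply: (@leq_trans (2 ^ s.+1)); last by rewrite leq_exp2l.
  by rewrite expnS leq_mul2l.
have Nx : N%:R <= x.
  have : (2 * N)%:R <= (2 ^ r)%:R :> R by rewrite ler_nat.
  by rewrite natrM; lra.
have Nr' : (N <= 2 ^ r)%N by apply: leq_trans Nr; rewrite leq_pmull.
have t1 : l2norm (fun i => uf i - u r i) <= h by exact: tail_l2.
have ur : l2norm (u r) <= b.
  apply: (le_trans (base_l2 (leqnn r))).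
  rewrite (_ : b = c2 * De * (5 * Num.sqrt x)); last by rewrite /b; ring.
  apply: ler_wpM2l; first by rewrite mulr_ge0 ?(ltW De0).
  apply: sqrtr_le_of_sqr; first by rewrite mulr_ge0 ?sqrtr_ge0.
  by rewrite exprMn sqr_sqrtr//; lra.
have uF : l2norm uf <= h + b.
  have -> : uf = (fun i => (uf i - u r i) + u r i) by apply/funext => i; ring.
  by apply: (le_trans (l2normD _ _)); exact: lerD.
have b1 : b `^ q <= 25 * c2 ^+ 2 * (De `^ q * x `^ (q / 2)).
  rewrite /b powRM ?sqrtr_ge0 ?mulr_ge0 ?(ltW De0)//.
  rewrite powRM ?mulr_ge0 ?(ltW De0)//.
  have -> : Num.sqrt x `^ q = x `^ (q / 2).
    rewrite -[in RHS](@sqr_sqrtr _ x); last lra.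
    by rewrite sqr_powR ?sqrtr_ge0//; congr powR; field.
  rewrite -mulrA; apply: ler_wpM2r; first by rewrite mulr_ge0 ?powR_ge0.
  have h1 : 1 <= 5 * c2 by lra.
  by apply: (le_trans (powR_scale h1)); rewrite exprMn; lra.
have xN : x `^ (q / 2) / Q = (x / N%:R) `^ (q / 2).
  rewrite powRM ?invr_ge0//; last lra.
  by rewrite -[N%:R^-1]powR_inv1// -powRrM mulN1r powRN.
have T1 : \sum_i `|uf i| `^ q <= N%:R * (576 * c2 ^+ 2 * (g `^ q / Q) +
    100 * c2 ^+ 2 * (De `^ q * (x / N%:R) `^ (q / 2))).
  apply: (le_trans (sum_powR_le_l2norm uf q12 N0)); rewrite NQ -xN.
  have NQ0 : 0 <= N%:R / Q by rewrite divr_ge0// ltW.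
  rewrite (_ : N%:R * (_ + _) = N%:R / Q * (576 * c2 ^+ 2 * g `^ q +
    100 * c2 ^+ 2 * (De `^ q * x `^ (q / 2)))); last by field; rewrite gt_eqF.
  apply: ler_wpM2l => //.
  apply: (@le_trans _ _ ((h + b) `^ q)).
    by rewrite ge0_ler_powR ?nnegrE ?l2norm_ge0 ?addr_ge0//; lra.
  apply: (le_trans (powRD_le4 q12 h0 b0)).
  by have := head_term; rewrite -/h; lra.
have T4 : N%:R * `|mf| <= N%:R * (c3 * (De `^ q * (x / N%:R) `^ (q / 2))).
  apply: ler_wpM2l => //; apply: (le_trans mean_base).
  rewrite -mulrA (mulrC _ De) DeM; apply: ler_wpM2l => //.
  rewrite -[leLHS]mulr1; apply: ler_wpM2l; first exact: powR_ge0.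
  have /(le_trans _) : 1 `^ (q / 2) <= (x / N%:R) `^ (q / 2).
    rewrite ge0_ler_powR ?nnegrE ?divr_ge0//; [lra|lra|].
    by rewrite ler_pdivlMr// mul1r.
  by apply; rewrite powR1.
apply: le_trans (ler_normB _ _) _; rewrite normrM (ger0_norm (ltW NR)).
have p0 : 0 <= \sum_i `|uf i| `^ q by apply: sumr_ge0 => i _; exact: powR_ge0.
rewrite (ger0_norm p0).
apply: (le_trans (lerD T1 T4)).
have a1 : 0 <= g `^ q / Q by rewrite divr_ge0 ?powR_ge0 ?(ltW Q0).
have a2 : 0 <= De `^ (q - 1) * (g / rt) by rewrite mulr_ge0 ?divr_ge0 ?(ltW rt0).
have a3 : 0 <= De `^ q * Num.sqrt (x / N%:R) by rewrite mulr_ge0 ?powR_ge0 ?sqrtr_ge0.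
have a4 : 0 <= De `^ q * (x / N%:R) `^ (q / 2) by rewrite mulr_ge0 ?powR_ge0.
rewrite -mulrDr (_ : chaining_const c1 c2 c3 * _ * _ =
  N%:R * (chaining_const c1 c2 c3 * moment_bound q De g x N)); last by ring.
apply: ler_wpM2l => //.
have [_ _ _ k4] := const_ge.
have k1 : 576 * c2 ^+ 2 <= chaining_const c1 c2 c3.
  by rewrite /chaining_const; have := sqr_ge0 c2; have := c10; have := c30; lra.
have k2 : 100 * c2 ^+ 2 + c3 <= chaining_const c1 c2 c3.
  by rewrite /chaining_const; have := sqr_ge0 c2; have := c10; have := c30; lra.
have := ler_wpM2r a1 k1; have := ler_wpM2r a4 k2; have := mulr_ge0 k4 a3.
have := mulr_ge0 k4 a2; rewrite /moment_bound -/rt -/Q; lra.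
Qed.

Lemma chaining_bound :
  `| \sum_i `|uf i| `^ q - N%:R * mf| <= chaining_const c1 c2 c3 * N%:R * moment_bound q De g x N.
Proof. by have [rs|sr] := leqP r s; [exact: chain_low|exact: chain_high]. Qed.

End chaining.

(** * The tail bound for a fixed admissible sequence *)

Section tail.
Local Open Scope ereal_scope.

(** The least level whose cardinality exponent [2 ^ r] reaches [x]. *)
Lemma pow2_ge_ex {R : realType} (x : R) : (1 <= x)%R ->
  exists r : nat, [/\ (x <= (2 ^ r)%:R)%R, ((2 ^ r)%:R <= 2 * x)%R &
    forall k, (k < r)%N -> ((2 ^ k)%:R <= x)%R].
Proof.
move=> x1.
have ex : exists r, (x <= (2 ^ r)%:R)%R.
  exists (Num.truncn x).+1.
  have /andP[_ /ltW h] := Num.Theory.truncn_itv (le_trans ler01 x1).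
  by apply: (le_trans h); rewrite ler_nat ltnW// ltn_expl.
exists (ex_minn ex); case: ex_minnP => r xr rmin; split=> //.
  case: r xr rmin => [|r] xr rmin; first by rewrite expn0; lra.
  rewrite expnS natrM ler_pM2l// leNgt; apply/negP => /ltW /rmin.
  by rewrite ltnn.
by move=> k kr; rewrite leNgt; apply/negP => /ltW /rmin; rewrite leqNgt kr.
Qed.

Lemma measure_expR_eq0 d (S : measurableType d) (R : realType)
    (P : probability S R) (B : set S) (n0 : nat) : measurable B ->
  (forall n, (n0 <= n)%N -> P B <= (expR (- n%:R))%:E) -> P B = 0.
Proof.
move=> mB h; apply/eqP; rewrite eq_le measure_ge0 andbT.
apply/lee_addgt0Pr => e e0; rewrite add0e.
pose n := maxn n0 (Num.truncn e^-1).+1.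
apply: (le_trans (h n (leq_maxl _ _))); rewrite lee_fin expRN.
have ei : (e^-1 < n%:R)%R.
  have /andP[_ hh] := Num.Theory.truncn_itv (ltW (etrans (invr_gt0 e) e0)).
  by apply: (lt_le_trans hh); rewrite ler_nat leq_maxr.
rewrite -[leRHS]invrK lef_pV2 ?posrE ?expR_gt0 ?invr_gt0//.
by apply: (le_trans (ltW ei)); have := @expR_ge1Dx R n%:R; lra.
Qed.

Context {d d'} {T : measurableType d} {S : measurableType d'} {R : realType}.
Context {P : probability S R} {X : {RV P >-> T}} {F : set (T -> R)}.
Context {rho : (T -> R) -> (T -> R) -> R} {C1 q De g : R} {N : nat}.
Context {Xs : 'I_N -> {RV P >-> T}} {A : nat -> set (T -> R)}.
Hypothesis C11 : (1 < C1)%R.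
Hypothesis q12 : (1 <= q <= 2)%R.
Hypothesis mF : forall f, F f -> measurable_fun setT f.
Hypothesis F0 : F (fun _ => 0%R).
Hypothesis dist : is_distance F rho.
Hypothesis subg : subgaussian_increments X F C1 rho.
Hypothesis De0 : (0 < De)%R.
Hypothesis rhoDe : forall f g, F f -> F g -> (rho f g <= De)%R.
Hypothesis N0 : (0 < N)%N.
Hypothesis indep : mutually_independent Xs.
Hypothesis iid : forall i A, measurable A ->
  distribution P (Xs i) A = distribution P X A.
Hypothesis admA : admissible F rho A.
Hypothesis g0 : (0 <= g)%R.
Hypothesis nearest : forall f, F f -> exists p : nat -> T -> R,
  (forall k, A k (p k)) /\
  (forall j, (\sum_(k < j) level_weight k * rho f (p k) <= g)%R).

(** [chaining_const] at the constants of [power_increment_tail],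
    [increment_tail] and [abs_moment_increment]. *)
Definition tail_const (C : R) : R :=
  chaining_const ((2 * psi1_const C + 10) * 24) (2 * psi2_const C)
    (24 * psi1_const C).

Let l2_bad (t : R) (a b : T -> R) : set S :=
  [set w | (2 * psi2_const C1 * rho a b * Num.sqrt (N%:R + t) <
      l2norm (fun i => (a (Xs i w) - b (Xs i w))))%R].

Let pow_bad (t : R) (a b : T -> R) : set S :=
  [set w | ((2 * psi1_const C1 + 10) * (24 * rho a b * De `^ (q - 1)) *
        Num.sqrt (t * N%:R) <
      `| \sum_(i < N) (`|a (Xs i w)| `^ q - `|b (Xs i w)| `^ q)
         - N%:R * (abs_moment X q a - abs_moment X q b)|)%R].

Let mcomp (f : T -> R) i : F f -> measurable_fun setT (fun w => f (Xs i w)).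
Proof. by move=> Ff; apply: measurableT_comp; [exact: mF|]. Qed.

Let mpow (f : T -> R) i : F f -> measurable_fun setT (fun w => (`|f (Xs i w)| `^ q)%R).
Proof.
move=> Ff; apply: (measurableT_comp (measurable_powR _)) => //.
by apply: measurableT_comp => //; exact: mcomp.
Qed.

Let measurable_l2_bad t a b : F a -> F b -> measurable (l2_bad t a b).
Proof.
move=> Fa Fb; apply: measurable_set_ltr => //; apply: measurable_l2norm => i.
by apply: measurable_funB; exact: mcomp.
Qed.

Let measurable_pow_bad t a b : F a -> F b -> measurable (pow_bad t a b).
Proof.
move=> Fa Fb; apply: measurable_set_ltr => //; apply: measurableT_comp => //.
apply: measurable_funB => //; apply: measurable_sum => i.
by apply: measurable_funB; exact: mpow.
Qed.

Let Bad k a b : set S := l2_bad (10 * (2 ^ k)%:R) a b `|`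
  (if (2 ^ k <= 2 * N)%N then pow_bad (10 * (2 ^ k)%:R) a b else set0).

(** The good event controls all pairs at the levels [k >= r].  A fixed [f] is
    compared with [p n] for an arbitrarily large [n], at the price of an event of
    mass [expR (- 10 * 2 ^ n)]: the exceptional set for [f] is null. *)
Lemma class_good_event (x : R) : (1 <= x)%R ->
  exists G : set S, [/\ measurable G, (1 - expR (- x))%:E <= P G &
    forall f, F f -> {ae P, forall w, G w ->
      (`| \sum_(i < N) `|f (Xs i w)| `^ q - N%:R * abs_moment X q f| <=
        tail_const C1 * N%:R * moment_bound q De g x N)%R}].
Proof.
move=> x1; have [r [xr rx _]] := pow2_ge_ex x1.
have N1 : (1 <= N%:R :> R)%R by rewrite ler1n.
have [s [Ns sN smin]] := pow2_ge_ex N1.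
have [AF _ cA incA _] := admA.
have Bad_le k a b : F a -> F b ->
    P (Bad k a b) <= (3 * expR (- (10 * (2 ^ k)%:R)))%:E.
  move=> Fa Fb; set t : R := (10 * (2 ^ k)%:R)%R.
  have t0 : (0 < t)%R by rewrite mulr_gt0// ltr0n expn_gt0.
  have h1 : P (l2_bad t a b) <= (expR (- t))%:E.
    by apply: (increment_tail C11 mF dist subg indep iid) => //; exact: ltW.
  have e0 : (0 <= expR (- t))%R by exact: expR_ge0.
  rewrite /Bad -/t; case: ifPn => kN; last first.
    by rewrite setU0; apply: (le_trans h1); rewrite lee_fin; lra.
  apply: (le_trans (measureU2 P (measurable_l2_bad _ Fa Fb) (measurable_pow_bad _ Fa Fb))).
  have h2 : P (pow_bad t a b) <= (2 * expR (- t))%:E.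
    apply: (power_increment_tail C11 q12 mF F0 dist subg De0 rhoDe N0 indep iid) => //.
    (* The restriction [2 ^ k <= 2 * N] keeps [t] in the sub-Gaussian range. *)
    rewrite t0/= /t; have : ((2 ^ k)%:R <= (2 * N)%:R :> R)%R by rewrite ler_nat.
    by rewrite natrM; lra.
  apply: (le_trans (leeD h1 h2)); rewrite -EFinD lee_fin; lra.
have mBad k a b : F a -> F b -> measurable (Bad k a b).
  move=> Fa Fb; apply: measurableU; first exact: measurable_l2_bad.
  by case: ifP => // _; exact: measurable_pow_bad.
have [G [mG PG HG]] := levels_good_event F0 AF cA mBad Bad_le xr.
exists G; split=> // f Ff.
have [p [Ap sump]] := nearest Ff.
have Fp k : F (p k) by exact: AF (Ap k).
have Aw k : A k.+1 (p k) by apply: incA.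
have tri k : (rho (p k.+1) (p k) <= rho f (p k) + rho f (p k.+1))%R.
  have [_ _ sym tr] := dist; rewrite addrC (sym f (p k.+1))//.
  exact: tr.
have psi20 : (1 <= psi2_const C1)%R by exact: psi2_const_ge1.
have psi10 : (1 <= psi1_const C1)%R by exact: psi1_const_ge1.
have P0 := powR_ge0 De (q - 1).
pose B := G `&` [set w | (tail_const C1 * N%:R * moment_bound q De g x N <
  `| \sum_(i < N) `|f (Xs i w)| `^ q - N%:R * abs_moment X q f|)%R].
have mB : measurable B.
  apply: measurableI => //; apply: measurable_set_ltr => //.
  apply: measurableT_comp => //; apply: measurable_funB => //.
  by apply: measurable_sum => i; exact: mpow.
suff PB : P B = 0.
  exists B; split=> // w /= /not_implyP[Gw /negP]; rewrite -ltNge => h.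
  by split.
apply: (@measure_expR_eq0 _ _ _ _ _ (maxn r s)) => // n; rewrite geq_max => /andP[rn sn].
apply: (@le_trans _ _ (P (l2_bad (10 * (2 ^ n)%:R) f (p n)))); last first.
  apply: (@le_trans _ _ (expR (- (10 * (2 ^ n)%:R)))%:E).
    exact: (increment_tail C11 mF dist subg indep iid).
  rewrite lee_fin ler_expR lerN2.
  have : (n%:R <= (2 ^ n)%:R :> R)%R by rewrite ler_nat ltnW// ltn_expl.
  by have : (0 <= (2 ^ n)%:R :> R)%R by []; lra.
apply: le_measure; rewrite ?inE//; first exact: measurable_l2_bad.
move=> w [Gw /=]; rewrite ltNge => /negP nb.
apply: contrapT => l2ok; apply: nb.
have l2le t a b : ~ l2_bad t a b w ->
    (l2norm (fun i => (a (Xs i w) - b (Xs i w))) <=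
      2 * psi2_const C1 * rho a b * Num.sqrt (N%:R + t))%R.
  by rewrite /l2_bad/= => /negP; rewrite -leNgt.
have powle t a b : ~ pow_bad t a b w ->
    (`| \sum_(i < N) (`|a (Xs i w)| `^ q - `|b (Xs i w)| `^ q)
         - N%:R * (abs_moment X q a - abs_moment X q b)| <=
     (2 * psi1_const C1 + 10) * (24 * rho a b * De `^ (q - 1)) *
        Num.sqrt (t * N%:R))%R.
  by rewrite /pow_bad/= => /negP; rewrite -leNgt.
have q0 : q != 0%R by rewrite gt_eqF//; have /andP[] := q12; lra.
have am0 : abs_moment X q (fun _ => 0%R) = 0%R.
  rewrite /abs_moment; under eq_integral do rewrite normr0 powR0//.
  by rewrite integral0.
have step k a b : (r <= k)%N -> A k.+1 a \/ a = (fun _ => 0%R) ->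
    A k.+1 b \/ b = (fun _ => 0%R) -> ~ l2_bad (10 * (2 ^ k)%:R) a b w.
  by move=> rk Aa Ab h; apply: (HG w Gw k rk a b Aa Ab); left.
have step' k a b : (r <= k)%N -> (2 ^ k <= 2 * N)%N ->
    A k.+1 a \/ a = (fun _ => 0%R) ->
    A k.+1 b \/ b = (fun _ => 0%R) -> ~ pow_bad (10 * (2 ^ k)%:R) a b w.
  by move=> rk kN Aa Ab h; apply: (HG w Gw k rk a b Aa Ab); right; rewrite kN.
have rho_ge0 a b : F a -> F b -> (0 <= rho a b)%R by exact: (dist_ge0 dist).
apply: (@chaining_bound R N q De g _ _ _ x (abs_moment X q f)
  (fun i => f (Xs i w)) (fun k i => p k (Xs i w)) (fun k => abs_moment X q (p k))
  (fun k => rho f (p k)) r s n) => //.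
- lra.
- lra.
- lra.
- by move=> k; exact: rho_ge0.
- move=> k rk; apply: (le_trans (l2le _ _ _ (step k _ _ rk (or_introl (Ap k.+1)) (or_introl (Aw k))))).
  apply: ler_wpM2r; first exact: sqrtr_ge0.
  by apply: ler_wpM2l; [lra|exact: tri].
- move=> k rk; have := l2le _ _ _ (step k _ _ rk (or_introl (Aw k)) (or_intror erefl)).
  under [X in (l2norm X <= _)%R -> _]eq_fun do rewrite subr0.
  move=> h; apply: (le_trans h); apply: ler_wpM2r; first exact: sqrtr_ge0.
  by apply: ler_wpM2l; [lra|exact: rhoDe].
- move=> k rk kN; apply: (le_trans (powle _ _ _ (step' k _ _ rk kN (or_introl (Ap k.+1)) (or_introl (Aw k))))).
  apply: ler_wpM2r; first exact: sqrtr_ge0.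
  rewrite -[leRHS]mulrA; apply: ler_wpM2l; first lra.
  by rewrite -mulrA ler_wpM2l//; apply: ler_wpM2r.
- move=> k rk kN; have := powle _ _ _ (step' k _ _ rk kN (or_introl (Aw k)) (or_intror erefl)).
  rewrite am0 subr0 normr0 powR0//.
  under eq_bigr do rewrite subr0.
  move=> h; apply: (le_trans h); apply: ler_wpM2r; first exact: sqrtr_ge0.
  rewrite -[leRHS]mulrA; apply: ler_wpM2l; first lra.
  by rewrite -mulrA ler_wpM2l//; apply: ler_wpM2r => //; exact: rhoDe.
- by move=> k; apply: (abs_moment_increment C11 q12 mF F0 dist subg De0 rhoDe).
- have := abs_moment_increment C11 q12 mF F0 dist subg De0 rhoDe Ff F0.
  rewrite am0 subr0 => h; apply: (le_trans h); apply: ler_wpM2l; last exact: rhoDe.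
  have D10 : (0 <= psi1_const C1)%R by lra.
  by apply: mulr_ge0 => //; exact: mulr_ge0.
- exact: l2le.
- by rewrite xr rx.
- by apply/andP; split; [move: Ns; rewrite ler_nat|move: sN; rewrite -natrM ler_nat].
- by move=> k ks; have := smin k ks; rewrite ler_nat.
Qed.

End tail.

(** * The supremum and its moments *)

Section rv_sup_tail.
Local Open Scope ereal_scope.
Context {d'} {S : measurableType d'} {R : realType} {P : probability S R}.

(** The random variable equal to the bound on [G] and to [+oo] outside dominates
    every member of the family, hence the supremum. *)
Lemma rv_sup_le_on (I : Type) (D : set I) (Y : I -> S -> \bar R) (Z : S -> \bar R)
    (G : set S) (b : R) : is_rv_sup P D Y Z -> measurable G ->
  (forall i, D i -> {ae P, forall w, G w -> Y i w <= b%:E}) ->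
  P G <= P [set w | Z w <= b%:E].
Proof.
move=> [mZ _ lubZ] mG hY.
pose W w : \bar R := if w \in G then b%:E else +oo.
have mW : measurable_fun setT W.
  apply: measurable_fun_if => //.
  apply: (@measurable_fun_bool _ _ _ _ true).
  by rewrite setTI (_ : _ @^-1` _ = G)//; by apply/seteqP; split=> w /=; [move/set_mem|move/mem_set].
have mB : measurable [set w | Z w <= b%:E].
  by rewrite -[X in measurable X]setTI; exact: emeasurable_fun_infty_c.
have ZW : {ae P, forall w, Z w <= W w}.
  apply: lubZ => // i Di; apply: filterS (hY i Di) => w h; rewrite /W.
  by case: ifPn => [/set_mem/h//|_]; rewrite leey.
have [B [mB' PB hB]] := ZW.
apply: (@le_trans _ _ (P ([set w | Z w <= b%:E] `|` B))).
  apply: le_measure; rewrite ?inE//; first exact: measurableU.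
  move=> w Gw; have [h|h] := pselect (Z w <= W w); last by right; exact: hB.
  by left; move: h; rewrite /W mem_set.
apply: (le_trans (measureU2 P mB mB')).
by rewrite [X in _ + X]PB adde0.
Qed.

(** With [b := 2 * B p] the event [k * b < Z] has mass at most
    [expR (- 2 * k * p)], which beats [(k + 1) `^ p]. *)
Lemma moment_of_tail (Z : S -> \bar R) (B : R -> R) (p : R) :
  measurable_fun setT Z -> {ae P, forall w, 0 <= Z w} ->
  (forall x, (1 <= x)%R -> (1 - expR (- x))%:E <= P [set w | Z w <= (B x)%:E]) ->
  (1 <= p)%R -> (forall y, (1 <= y)%R -> (B (y * p) <= y * B p)%R) -> (0 < B p)%R ->
  (\int[P]_w (Z w `^ p)) `^ p^-1 <= (4 * B p)%:E.
Proof.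
move=> mZ Z0 tail p1 Bp B0; have p0 : (0 < p)%R by lra.
have mle c : measurable [set w | Z w <= c].
  by rewrite -[X in measurable X]setTI; exact: emeasurable_fun_infty_c.
have PC c x : (1 <= x)%R -> (B x)%:E <= c -> P (~` [set w | Z w <= c]) <= (expR (- x))%:E.
  move=> x1 Bc; rewrite probability_setC// -[X in _ <= X](_ : 1 - (1 - expR (- x))%:E = _).
    rewrite leeB//; apply: (le_trans (tail _ x1)); apply: le_measure; rewrite ?inE//.
    by move=> w /= h; apply: le_trans Bc.
  by rewrite -EFinB; congr EFin; ring.
have Zfin : {ae P, forall w, Z w < +oo}.
  exists (~` [set w | Z w < +oo]); split=> //.
    apply: measurableC; rewrite -[X in measurable X]setTI.
    exact: emeasurable_fun_infty_o.
  apply: (@measure_expR_eq0 _ _ _ _ _ 1) => [|n n1].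
    apply: measurableC; rewrite -[X in measurable X]setTI.
    exact: emeasurable_fun_infty_o.
  apply: le_trans (PC (B n%:R)%:E n%:R _ _) => //; last by rewrite ler1n.
  apply: le_measure; rewrite ?inE.
  - apply: measurableC; rewrite -[X in measurable X]setTI.
    exact: emeasurable_fun_infty_o.
  - exact: measurableC.
  - by move=> w /= h h'; apply: h; apply: le_lt_trans h' (ltry _).
pose b : R := (2 * B p)%R; have b0 : (0 < b)%R by rewrite mulr_gt0.
pose E k : set S := if k is 0%N then setT else ~` [set w | Z w <= (k%:R * b)%:E].
have mE k : measurable (E k) by case: k => [|k] //=; exact: measurableC.
have PE k : P (E k) <= (expR (- (2 * k%:R * p)))%:E.
  case: k => [|k]; first by rewrite mulr0 mul0r oppr0 expR0 probability_le1.
  have k1 : (1 <= 2 * k.+1%:R :> R)%R.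
    have k1 : (1 <= k.+1%:R :> R)%R by rewrite ler1n.
    lra.
  apply: PC; first by nra.
  by rewrite lee_fin; apply: (le_trans (Bp _ k1)); rewrite /b; lra.
pose c k : R := ((k.+1%:R * b) `^ p)%R.
have intZ : \int[P]_w (Z w `^ p) <= (2 * b `^ p)%:E.
  apply: (@integral_le_layers _ _ _ _ _ E c) => //.
  - by apply: (measurableT_comp (measurable_poweR _)).
  - by move=> w; exact: poweR_ge0.
  - by move=> k; exact: powR_ge0.
  - by rewrite mulr_ge0 ?powR_ge0.
  - apply: filterS2 Z0 Zfin => w z0 zoo.
    have zf : Z w \is a fin_num by rewrite ge0_fin_numE.
    have [z zE] : exists z, Z w = z%:E by exists (fine (Z w)); rewrite fineK.
    rewrite zE in z0 *; rewrite lee_fin in z0.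
    have zb0 : (0 <= z / b)%R by rewrite divr_ge0// ltW.
    have /andP[h1 h2] := Num.Theory.truncn_itv zb0.
    have up (k : nat) : (z <= k.+1%:R * b)%R -> z%:E `^ p <= (c k)%:E.
      move=> h; rewrite poweR_EFin lee_fin /c ge0_ler_powR ?nnegrE//; first exact: ltW.
      by rewrite mulr_ge0// ltW.
    move: h1 h2; rewrite ler_pdivlMr// ltr_pdivrMr//.
    case: (Num.truncn (z / b)) => [|k] h1 h2.
      by exists 0%N; split=> //; apply: up; exact: ltW.
    have [e|ne] := eqVneq z (k.+1%:R * b)%R.
      case: k {h1 h2} e => [|k] e.
        by exists 0%N; split=> //; apply: up; rewrite e.
      exists k.+1; split; last by apply: up; rewrite e.
      by rewrite /E/= zE lee_fin e ler_pM2r// ler_nat ltnn.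
    exists k.+1; split; last by apply: up; exact: ltW.
    rewrite /E/= zE lee_fin => h; have := lt_neqAle (k.+1%:R * b)%R z.
    by rewrite eq_sym ne h1/= ltNge h.
  - move=> k; have ck0 : 0 <= (c k)%:E by rewrite lee_fin powR_ge0.
    apply: (le_trans (lee_wpmul2l ck0 (PE k))); rewrite -EFinM lee_fin.
    rewrite ler_pdivlMr ?ltr0n ?expn_gt0// expnS natrM /c powRM//; last exact: ltW.
    have k2 := @pow2_le_expR R k.
    have : (k.+1%:R `^ p * expR (- (2 * k%:R * p)) <= expR (- k%:R))%R.
      rewrite (_ : - (2 * k%:R * p) = - (2 * k%:R) * p)%R; last by ring.
      rewrite expRM -powRM ?expR_ge0//.
      apply: (@le_trans _ _ (expR (- k%:R) `^ p)%R).
        rewrite ge0_ler_powR ?nnegrE ?mulr_ge0 ?expR_ge0//; first exact: ltW.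
        rewrite (_ : - (2 * k%:R) = - k%:R + - k%:R)%R; last by ring.
        rewrite expRD mulrA ler_piMl ?expR_ge0// expRN ler_pdivrMr ?expR_gt0//.
        by rewrite mul1r -natr1 addrC expR_ge1Dx.
      rewrite -expRM ler_expR mulNr lerN2 ler_peMr//.
    move=> h; rewrite (_ : _ * (2 * _) =
      2 * b `^ p * ((2 ^ k)%:R * (k.+1%:R `^ p * expR (- (2 * k%:R * p)))))%R; last by ring.
    rewrite ler_piMr ?mulr_ge0 ?powR_ge0//.
    apply: (@le_trans _ _ ((2 ^ k)%:R * expR (- k%:R))%R); first by rewrite ler_wpM2l.
    by rewrite expRN ler_pdivrMr ?expR_gt0// mul1r.
apply: (@le_trans _ _ ((2 * b `^ p)%:E `^ p^-1)).
  apply: gt0_ler_poweR; rewrite ?in_itv/= ?leey ?andbT//.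
  - by rewrite invr_ge0 ltW.
  - by apply: integral_ge0 => w _; exact: poweR_ge0.
  - by rewrite lee_fin mulr_ge0 ?powR_ge0.
rewrite poweR_EFin lee_fin powRM ?powR_ge0// -powRrM mulfV ?gt_eqF// powRr1 ?(ltW b0)//.
have h2 : (2 `^ p^-1 <= 2 :> R)%R.
  by apply: ler1_powR; rewrite ?ler1n// invf_le1.
have := ler_wpM2r (ltW b0) h2; rewrite /b; lra.
Qed.

End rv_sup_tail.

(** * Nearest points and Talagrand's functional *)

Section gamma2.
Local Open Scope ereal_scope.
Context {R : realType} {U : Type} {F : set U} {rho : U -> U -> R}.
Hypothesis dist : is_distance F rho.

Lemma admissible_neq0 (A : nat -> set U) k : admissible F rho A -> exists z, A k z.
Proof.
move=> [_ A0 _ incA _]; have [z Az] : exists z, A 0%N z.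
  apply: contrapT => h; have A00 : A 0%N = set0.
    by rewrite -subset0 => z Az; apply: h; exists z.
  by move: A0; rewrite A00 card_eq_sym card_eq0 => /eqP /seteqP[/(_ 0%N)/(_ isT)].
by exists z; elim: k => // k; exact: incA.
Qed.

Lemma dist_to_attained (A : nat -> set U) k v : admissible F rho A ->
  exists2 a, A k a & dist_to rho v (A k) = (rho v a)%:E.
Proof.
move=> adm; have [z Az] := admissible_neq0 k adm.
have [_ _ cA _ _] := adm.
have [e [eA eS]] := enum_card_le z (cA k).
pose i0 : 'I_(2 ^ 2 ^ k).+1 := ord0.
have Ae i : A k (e i) by case: (eA i) => // ->.
case: (Order.TotalTheory.arg_minP (fun i : 'I_(2 ^ 2 ^ k).+1 => rho v (e i)) (isT : xpredT i0)).
move=> i _ imin; exists (e i) => //.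
apply/eqP; rewrite eq_le; apply/andP; split.
  by apply: ereal_inf_lbound; exists (e i).
apply: le_ereal_inf_tmp => _ [a Aa <-]; rewrite lee_fin.
have [j jM <-] := eS a (or_introl Aa).
exact: (imin (Ordinal jM)).
Qed.

Lemma level_weightE k : (level_weight k = 2 `^ (k%:R / 2) :> R)%R.
Proof.
by rewrite /level_weight powRrM powR_mulrn// powR12_sqrt// natrX.
Qed.

Definition chaining_sum (A : nat -> set U) : \bar R := ereal_sup
  [set \sum_(0 <= n <oo) ((2 `^ (n%:R / 2))%R)%:E * dist_to rho v (A n)
    | v in F].

Lemma nearest_points (A : nat -> set U) (g : R) : admissible F rho A ->
  chaining_sum A <= g%:E ->
  forall f, F f -> exists p : nat -> U, (forall k, A k (p k)) /\
    (forall j, (\sum_(k < j) level_weight k * rho f (p k) <= g)%R).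
Proof.
move=> adm hg f Ff.
have [AF _ _ _ _] := adm.
have /choice[p hp] k : exists a, A k a /\ dist_to rho f (A k) = (rho f a)%:E.
  by have [a Aa e] := dist_to_attained k f adm; exists a.
exists p; split=> [k|j]; first by case: (hp k).
rewrite -lee_fin; apply: le_trans hg.
apply: (@le_trans _ _ (\sum_(0 <= n <oo)
    ((2 `^ (n%:R / 2))%R)%:E * dist_to rho f (A n))); last first.
  by apply: ereal_sup_ubound; exists f.
apply: le_trans (nneseries_lim_ge j _); last first.
  move=> n _ _; rewrite mule_ge0 ?lee_fin ?powR_ge0// (proj2 (hp n)) lee_fin.
  case: dist => h _ _ _; apply: h => //; apply: (AF n); by case: (hp n).
rewrite big_mkord -sumEFin; apply: lee_sum => k _.
by rewrite (proj2 (hp k)) -EFinM level_weightE.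
Qed.

Lemma chaining_sum_ge0 A : (exists f, F f) -> admissible F rho A ->
  0 <= chaining_sum A.
Proof.
move=> [f Ff] [AF _ _ _ _]; apply: (@le_trans _ _ (\sum_(0 <= n <oo)
    ((2 `^ (n%:R / 2))%R)%:E * dist_to rho f (A n))); last first.
  by apply: ereal_sup_ubound; exists f.
apply: nneseries_ge0 => n _ _; rewrite mule_ge0 ?lee_fin ?powR_ge0//.
apply: le_ereal_inf_tmp => _ [a Aa <-]; rewrite lee_fin.
by case: dist => h _ _ _; apply: h => //; exact: AF Aa.
Qed.

Lemma gamma2_ge0 : (exists f, F f) -> 0 <= gamma2 F rho.
Proof.
move=> F0; apply: le_ereal_inf_tmp => _ [A adm <-].
exact: chaining_sum_ge0.
Qed.

(** The level [0] has a single point, so two members of the class are joined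
    through it at a cost of at most two chaining sums. *)
Lemma dist_le_gamma2 f h : F f -> F h -> (rho f h / 2)%:E <= gamma2 F rho.
Proof.
move=> Ff Fh; apply: le_ereal_inf_tmp => _ [A adm <-].
rewrite -/(chaining_sum A).
have [AF A0 _ _ _] := adm.
case E : (chaining_sum A) => [g| |].
- have hg : chaining_sum A <= g%:E by rewrite E.
  have [p [pA ps]] := nearest_points adm hg Ff.
  have [p' [pA' ps']] := nearest_points adm hg Fh.
  have pp : p 0%N = p' 0%N.
    have /pcard_leP/unsquash e : (A 0%N #<= `I_1)%card.
      by move: A0; rewrite card_eq_le => /andP[].
    have ei : {in A 0%N &, injective e} by exact: inj.
    have e0 a : A 0%N a -> e a = 0%N.
      move=> Aa; have : `I_1 (e a) by exact: funS.
      by rewrite /= ltnS leqn0 => /eqP.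
    by apply: ei; [exact: mem_set|exact: mem_set|rewrite !e0].
  have := ps 1%N; have := ps' 1%N.
  rewrite !big_ord1/= /level_weight expn0 sqrtr1 !mul1r lee_fin -pp => h1 h2.
  have [_ _ sym tr] := dist; have Fp := AF 0%N _ (pA 0%N).
  have := tr f (p 0%N) h Ff Fp Fh; rewrite (sym (p 0%N) h)//; lra.
- by rewrite leey.
- have : 0 <= chaining_sum A by apply: chaining_sum_ge0 => //; exists f.
  by rewrite E.
Qed.

Lemma near_optimal_admissible (g : R) : gamma2 F rho = g%:E -> (0 < g)%R ->
  exists2 A, admissible F rho A & chaining_sum A <= (2 * g)%:E.
Proof.
move=> gE g0; have : gamma2 F rho < (2 * g)%:E by rewrite gE lte_fin; lra.
by move=> /ereal_inf_lt[_ [A adm <-] /ltW h]; exists A.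
Qed.

End gamma2.

Section moment_bound_scaling.
Context {R : realType}.

Lemma moment_bound_ge0 (q De g x : R) N : 0 <= De -> 0 <= g ->
  0 <= moment_bound q De g x N.
Proof.
move=> De0 g0; rewrite /moment_bound !addr_ge0 ?mulr_ge0 ?divr_ge0 ?powR_ge0 ?sqrtr_ge0//.
by rewrite addr_ge0 ?powR_ge0 ?sqrtr_ge0.
Qed.

Lemma moment_bound_gt0 (q De g x : R) N : 0 < De -> 0 <= g -> 0 < x ->
  (0 < N)%N -> 0 < moment_bound q De g x N.
Proof.
move=> De0 g0 x0 N0; rewrite /moment_bound ltr_wpDl//.
  by rewrite addr_ge0 ?mulr_ge0 ?divr_ge0 ?powR_ge0 ?sqrtr_ge0.
rewrite mulr_gt0 ?powR_gt0// ltr_wpDr ?powR_ge0// sqrtr_gt0 divr_gt0//.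
by rewrite ltr0n.
Qed.

Lemma moment_bound_double (q De g x : R) N : 1 <= q <= 2 -> 0 <= De -> 0 <= g ->
  moment_bound q De (2 * g) x N <= 4 * moment_bound q De g x N.
Proof.
move=> /andP[q1 q2] De0 g0; rewrite /moment_bound powRM//.
have a1 : 0 <= g `^ q / N%:R `^ (q / 2) by rewrite divr_ge0 ?powR_ge0.
have a2 : 0 <= De `^ (q - 1) * (g / Num.sqrt N%:R).
  by rewrite mulr_ge0 ?divr_ge0 ?powR_ge0 ?sqrtr_ge0.
have a3 : 0 <= De `^ q * (Num.sqrt (x / N%:R) + (x / N%:R) `^ (q / 2)).
  by rewrite mulr_ge0 ?addr_ge0 ?powR_ge0 ?sqrtr_ge0.
by have := ler_wpM2r a1 (powR2_le4 q2); lra.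
Qed.

Lemma moment_bound_scale (q De g p y : R) N : 1 <= q <= 2 -> 0 <= De -> 0 <= g ->
  0 <= p -> 1 <= y -> moment_bound q De g (y * p) N <= y * moment_bound q De g p N.
Proof.
move=> /andP[q1 q2] De0 g0 p0 y1; rewrite /moment_bound.
have a1 : 0 <= g `^ q / N%:R `^ (q / 2) by rewrite divr_ge0 ?powR_ge0.
have a2 : 0 <= De `^ (q - 1) * (g / Num.sqrt N%:R).
  by rewrite mulr_ge0 ?divr_ge0 ?powR_ge0 ?sqrtr_ge0.
have y0 : 0 <= y by lra.
have pN : 0 <= p / N%:R by rewrite divr_ge0.
have h1 : Num.sqrt (y * p / N%:R) <= y * Num.sqrt (p / N%:R).
  apply: sqrtr_le_of_sqr; first by rewrite mulr_ge0 ?sqrtr_ge0.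
  rewrite exprMn sqr_sqrtr// -mulrA; apply: ler_wpM2r => //.
  by rewrite expr2 ler_peMl.
have h2 : (y * p / N%:R) `^ (q / 2) <= y * (p / N%:R) `^ (q / 2).
  rewrite -mulrA powRM//; apply: ler_wpM2r; first exact: powR_ge0.
  by apply: ler1_powR; lra.
have h3 := ler_wpM2l (powR_ge0 De q) (lerD h1 h2).
have b1 := ler_peMl a1 y1; have b2 := ler_peMl a2 y1.
lra.
Qed.

Lemma moment_dev_boundE (q De g x : R) N :
  moment_dev_bound q g%:E De%:E N x = (moment_bound q De g x N)%:E.
Proof. by rewrite /moment_dev_bound !poweR_EFin -!EFinM -!EFinD. Qed.

End moment_bound_scaling.

(** * The tail and the moments over the class *)

Section class_tail.
Local Open Scope ereal_scope.
Context {d d'} {T : measurableType d} {S : measurableType d'} {R : realType}.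
Context {P : probability S R} {X : {RV P >-> T}} {F : set (T -> R)}.
Context {rho : (T -> R) -> (T -> R) -> R} {C1 q De g : R} {N : nat}.
Context {Xs : 'I_N -> {RV P >-> T}} {Z : S -> \bar R}.
Hypothesis C11 : (1 < C1)%R.
Hypothesis q12 : (1 <= q <= 2)%R.
Hypothesis mF : forall f, F f -> measurable_fun setT f.
Hypothesis F0 : F (fun _ => 0%R).
Hypothesis dist : is_distance F rho.
Hypothesis subg : subgaussian_increments X F C1 rho.
Hypothesis De0 : (0 < De)%R.
Hypothesis rhoDe : forall f g, F f -> F g -> (rho f g <= De)%R.
Hypothesis N0 : (0 < N)%N.
Hypothesis indep : mutually_independent Xs.
Hypothesis iid : forall i A, measurable A ->
  distribution P (Xs i) A = distribution P X A.
Hypothesis supZ : is_rv_sup P F (moment_dev q X Xs) Z.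

Lemma moment_devE f w : F f -> moment_dev q X Xs f w =
  (N%:R^-1 * `| \sum_(i < N) `|f (Xs i w)| `^ q - N%:R * abs_moment X q f|)%R%:E.
Proof.
move=> Ff; have iF := power_integrable C11 q12 mF F0 dist subg De0 rhoDe Ff.
have NR : (0 < N%:R :> R)%R by rewrite ltr0n.
have EE : 'E_P[fun v => (`|f (X v)| `^ q)%R] = (abs_moment X q f)%:E.
  by rewrite unlock /abs_moment fineK//; exact: integrable_fin_num.
rewrite /moment_dev EE -EFinB abse_EFin; congr EFin.
rewrite -[in RHS](@ger0_norm _ N%:R^-1) ?invr_ge0// -normrM mulrBr mulrA mulVf ?mul1r//.
by rewrite gt_eqF.
Qed.

Lemma tail_const_gt0 : (0 < tail_const C1)%R.
Proof.
have h1 : (1 <= psi1_const C1)%R by exact: psi1_const_ge1.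
rewrite /tail_const /chaining_const.
by have := sqr_ge0 (2 * psi2_const C1)%R; lra.
Qed.

(** A near-optimal admissible sequence replaces the functional by twice its
    value, which costs a factor [4]. *)
Lemma class_tail (x : R) : gamma2 F rho = g%:E -> (0 < g)%R -> (1 <= x)%R ->
  (1 - expR (- x))%:E <=
    P [set w | Z w <= (4 * tail_const C1 * moment_bound q De g x N)%:E].
Proof.
move=> gE g0 x1; have NR : (0 < N%:R :> R)%R by rewrite ltr0n.
have [A adm cA] := near_optimal_admissible gE g0.
have g20 : (0 <= 2 * g)%R by lra.
have [G [mG PG HG]] := class_good_event C11 q12 mF F0 dist subg De0 rhoDe N0
  indep iid adm g20 (nearest_points dist adm cA) x1.
apply: (le_trans PG); apply: (rv_sup_le_on supZ mG) => f Ff.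
apply: filterS (HG f Ff) => w h Gw; rewrite moment_devE// lee_fin.
rewrite -ler_pdivlMl ?invr_gt0// invrK; apply: (le_trans (h Gw)).
rewrite (_ : N%:R * _ = tail_const C1 * N%:R * (4 * moment_bound q De g x N))%R;
  last by ring.
apply: ler_wpM2l; first by rewrite mulr_ge0// ltW// tail_const_gt0.
by apply: moment_bound_double; rewrite // ltW.
Qed.

Lemma rv_sup_ge0 : {ae P, forall w, 0 <= Z w}.
Proof.
case: supZ => _ h _; apply: filterS (h _ F0) => w; apply: le_trans.
exact: abse_ge0.
Qed.

End class_tail.

Local Open Scope ereal_scope.

Theorem theorem2 :
  forall (R : realType) (C1 : R), (1 < C1)%R ->
  forall q : R, (1 <= q <= 2)%R ->
  exists C : R, (0 < C)%R /\
  forall (d : measure_display) (T : measurableType d) (mu : probability T R)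
    (d' : measure_display) (S : measurableType d') (P : probability S R)
    (X : {RV P >-> T})
    (F : set (T -> R)) (rho : (T -> R) -> (T -> R) -> R)
    (N : nat) (Xs : 'I_N -> {RV P >-> T}) (Z : S -> \bar R),
  (forall A, measurable A -> distribution P X A = mu A) ->
  (forall f, F f -> f \in Lfun mu q%:E) ->
  F (fun _ => 0%R) ->
  is_distance F rho ->
  subgaussian_increments X F C1 rho ->
  (1 <= N)%N ->
  (forall i A, measurable A -> distribution P (Xs i) A = distribution P X A) ->
  mutually_independent Xs ->
  is_rv_sup P F (moment_dev q X Xs) Z ->
  (forall x : R, (1 <= x)%R ->
     (1 - expR (- x))%R%:E <=
       P [set w | Z w <= C%:E *
            moment_dev_bound q (gamma2 F rho) (diam F rho) N x]) /\
  (forall p : R, (1 <= p)%R ->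
     (\int[P]_w (Z w `^ p)) `^ p^-1 <=
       C%:E * moment_dev_bound q (gamma2 F rho) (diam F rho) N p).
Proof.
move=> R C1 C11 q q12; pose K := tail_const C1.
have K0 : (0 < K)%R by exact: tail_const_gt0.
have K1 : (0 < 16 * K)%R by lra.
exists (16 * K)%R; split=> //.
move=> d T mu d' S P X F rho N Xs Z _ FL F0 dist subg N0 iid indep supZ.
have mF f : F f -> measurable_fun setT f.
  by move=> /FL; rewrite inE => /andP[/[!inE]].
have mZ : measurable_fun setT Z by case: supZ.
have mle c : measurable [set w | Z w <= c].
  by rewrite -[X in measurable X]setTI; exact: emeasurable_fun_infty_c.
have Z0 : {ae P, forall w, 0 <= Z w} by exact: rv_sup_ge0 supZ.
have g0 : 0 <= gamma2 F rho by apply: (gamma2_ge0 dist); exists (fun _ => 0%R).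
have rho_diam f h : F f -> F h -> (rho f h)%:E <= diam F rho.
  by move=> Ff Fh; apply: ereal_sup_ubound; exists f, h.
have De0 : 0 <= diam F rho.
  apply: le_trans (rho_diam _ _ F0 F0); rewrite lee_fin.
  by case: dist => h _ _ _; exact: h.
have q0 : (0 < q)%R by have /andP[] := q12; lra.
have qn0 : q != 0%R by rewrite gt_eqF.
have NR : (0 < N%:R :> R)%R by rewrite ltr0n.
(* An infinite functional or diameter makes the bound trivial. *)
have infinite_case : (forall x : R, (1 <= x)%R ->
    moment_dev_bound q (gamma2 F rho) (diam F rho) N x = +oo) ->
  (forall x : R, (1 <= x)%R ->
     (1 - expR (- x))%R%:E <=
       P [set w | Z w <= (16 * K)%:E *
            moment_dev_bound q (gamma2 F rho) (diam F rho) N x]) /\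
  (forall p : R, (1 <= p)%R ->
     (\int[P]_w (Z w `^ p)) `^ p^-1 <=
       (16 * K)%:E * moment_dev_bound q (gamma2 F rho) (diam F rho) N p).
  move=> h; split=> x x1; rewrite h// gt0_muley ?lte_fin ?leey//.
  rewrite (_ : [set _ | _] = setT); last first.
    by apply/seteqP; split=> w //= _; rewrite leey.
  by rewrite probability_setT lee_fin gerBl expR_ge0.
have t3 (x : R) : (1 <= x)%R ->
    0 < (Num.sqrt (x / N%:R) + (x / N%:R) `^ (q / 2))%:E :> \bar R.
  move=> x1; rewrite lte_fin ltr_wpDr ?powR_ge0// sqrtr_gt0 divr_gt0//; lra.
have t2 : 0 <= diam F rho `^ (q - 1) * (gamma2 F rho * ((Num.sqrt N%:R)^-1)%:E).
  by rewrite !mule_ge0 ?poweR_ge0// lee_fin invr_ge0 sqrtr_ge0.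
have t1 : 0 <= gamma2 F rho `^ q * ((N%:R `^ (q / 2))^-1)%:E.
  by rewrite !mule_ge0 ?poweR_ge0// lee_fin invr_ge0 powR_ge0.
case gE : (gamma2 F rho) g0 => [g| |] // g0; last first.
  rewrite -gE; apply: infinite_case => x x1; rewrite /moment_dev_bound gE.
  rewrite (poweRyr qn0) gt0_mulye ?lte_fin ?invr_gt0 ?powR_gt0//.
  rewrite -addeA addye// gt_eqF// (@lt_le_trans _ _ 0)// ?ltNy0//.
  rewrite adde_ge0//; first by rewrite -gE.
  by rewrite mule_ge0 ?poweR_ge0// ltW// t3.
case DE : (diam F rho) De0 => [De| |] // De0; last first.
  rewrite -DE -gE; apply: infinite_case => x x1; rewrite /moment_dev_bound DE (poweRyr qn0).
  rewrite gt0_mulye ?t3// addey// gt_eqF// (@lt_le_trans _ _ 0)// ?ltNy0//.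
  by rewrite adde_ge0// -DE.
rewrite lee_fin in g0; rewrite lee_fin in De0.
have rhoDe f h : F f -> F h -> (rho f h <= De)%R.
  by move=> Ff Fh; rewrite -lee_fin -DE; exact: rho_diam.
have mb0 (x : R) : (0 <= moment_bound q De g x N)%R by exact: moment_bound_ge0.
(* A class of diameter zero is reduced to the zero function. *)
have [D0|Dn] := eqVneq De 0%R.
  have Z00 : {ae P, forall w, Z w <= 0}.
    case: supZ => _ _ h; apply: h => // f Ff; apply: aeW => w.
    have -> : f = (fun _ => 0%R).
      have [h1 h2 _ _] := dist; apply/(h2 _ _ Ff F0)/eqP.
      by have := rhoDe _ _ Ff F0; rewrite D0 => h3; rewrite eq_le h3 h1.
    rewrite /moment_dev [X in 'E_P[X]](_ : _ = cst 0%R); last first.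
      by apply/funext => v /=; rewrite normr0 powR0// gt_eqF.
    rewrite expectation_cst big1 ?mulr0 ?sube0 ?abse0// => i _.
    by rewrite normr0 powR0// gt_eqF.
  split=> x x1; rewrite moment_dev_boundE -EFinM.
    apply: (@le_trans _ _ 1); first by rewrite lee_fin gerBl expR_ge0.
    have [B [mB PB hB]] := Z00.
    have -> : 1 = P (~` B).
      by rewrite probability_setC// [X in 1 - X]PB sube0.
    apply: le_measure; rewrite ?inE//; first exact: measurableC.
    move=> w /= Bw; have [h|h] := pselect (Z w <= 0); last by case: Bw; exact: hB.
    by apply: (le_trans h); rewrite lee_fin mulr_ge0// ltW.
  rewrite (ae_eq_integral (cst 0)) ?integral0 ?poweR0r//.
  - by rewrite lee_fin mulr_ge0// ltW.
  - by rewrite invr_neq0// gt_eqF//; lra.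
  - exact: (measurableT_comp (measurable_poweR _)).
  - apply: filterS2 Z0 Z00 => w a b _; have -> : Z w = 0 by apply/eqP; rewrite eq_le a b.
    by rewrite poweR0r// gt_eqF//; lra.
have Dp : (0 < De)%R by rewrite lt_neqAle eq_sym Dn.
(* The functional dominates half the diameter, so it does not vanish and some
   admissible sequence comes within a factor two of it. *)
have gp : (0 < g)%R.
  have : diam F rho <= (2 * g)%:E.
    apply: ge_ereal_sup => _ [f [h [Ff Fh ->]]]; rewrite lee_fin.
    by have := dist_le_gamma2 dist Ff Fh; rewrite gE lee_fin; lra.
  by rewrite DE lee_fin; lra.
have tail x := class_tail C11 q12 mF F0 dist subg Dp rhoDe N0 indep iid supZ gE gp (x := x).
split=> x x1; rewrite moment_dev_boundE -EFinM.
  apply: (le_trans (tail x x1)); apply: le_measure; rewrite ?inE//.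
  move=> w /= h; apply: (le_trans h); rewrite lee_fin; apply: ler_wpM2r => //.
  by rewrite -/K; lra.
apply: (le_trans (@moment_of_tail _ _ _ P Z
  (fun x => 4 * tail_const C1 * moment_bound q De g x N)%R x mZ Z0 tail x1 _ _)).
- move=> y y1; rewrite -/K (mulrCA y); apply: ler_wpM2l; first lra.
  by apply: moment_bound_scale => //; lra.
- by rewrite mulr_gt0 ?moment_bound_gt0 -/K//; lra.
- by rewrite lee_fin -/K mulrA; apply: ler_wpM2r => //; lra.
Qed.
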